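(* Let $R$ be a left and right noetherian ring, $n\geq 1$ and $k\geq 0$ integers. The following are equivalent: (a) $R$ is $G_n(k)^{op}$; (b) $\mathrm{fd}\, I_i(A)\leq i+k$ for every $0\leq i\leq n-1$ and every finitely generated $n$-syzygy left $R$-module $A$; (c) $\mathrm{fd}\, I_i(G)\leq i+k$ for every $0\leq i\leq n-1$ and every finitely generated left $R$-module $G$ that has Gorenstein dimension zero.
   Context: For a module $M$, $0\to M\to I_0(M)\to I_1(M)\to\cdots$ denotes its minimal injective resolution, and $\mathrm{fd}$ denotes flat dimension. $I_i(R)$ (resp. $I_i(R^{op})$) refers to $R$ as a left (resp. right) $R$-module. $R$ is $G_n(k)$ if $\mathrm{fd}\, I_i(R^{op})\leq i+k$ for all $0\leq i\leq n-1$; $R$ is $G_n(k)^{op}$ if $R^{op}$ is $G_n(k)$, i.e. $\mathrm{fd}\, I_i(R)\leq i+k$ for all $0\leq i\leq n-1$. A finitely generated left $R$-module $M$ is an $n$-syzygy module if there is an exact sequence $0\to M\to P_{n-1}\to\cdots\to P_0\to A'\to 0$ of finitely generated left $R$-modules with every $P_i$ projective. A finitely generated left $R$-module $M$ has Gorenstein dimension zero if $\mathrm{Ext}^i_R(M,R)=0$ and $\mathrm{Ext}^i_{R^{op}}(\mathrm{Tr}\, M,R)=0$ for all $i\geq 1$, where $\mathrm{Tr}\,M$ is the Auslander transpose of $M$. *)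

(* Defs.v *)
From HB Require Import structures.
From mathcomp Require Import all_boot all_algebra.
From mathcomp Require Import boolp.

Set Implicit Arguments.
Unset Strict Implicit.
Unset Printing Implicit Defensive.

Import GRing.Theory.
Local Open Scope ring_scope.

(* A left R-module is an [lmodType R]; a right R-module is an [lmodType R^c],
   the product [x r] being written [(r : R^c) *: x].  R as a left module over
   itself is [R^o]; R as a right module over itself is [R^c^o].

   Projective and minimal injective resolutions, tensor products and transposes
   are data which exist and are unique up to the relevant equivalence, none of
   the notions below depending on the choice.  The notions are stated for every
   choice of these data. *)

Section Modules.
Variable R : pzRingType.
Implicit Types A B C M N P E : lmodType R.

Definition surjective (A B : Type) (f : A -> B) : Prop := forall y, exists x, f x = y.

Definition exact A B C (f : {linear A -> B}) (g : {linear B -> C}) : Prop :=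
  forall y, g y = 0 <-> exists x, f x = y.

Definition zero_module M : Prop := forall x : M, x = 0.

Definition isomorphic A B : Prop := exists f : {linear A -> B}, bijective f.

Definition finitely_generated M : Prop :=
  exists (m : nat) (g : 'I_m -> M),
    forall x, exists c : 'I_m -> R, x = \sum_i c i *: g i.

Definition noetherian_module M : Prop :=
  forall S : nat -> {pred M},
    (forall i, submod_closed (S i)) ->
    (forall i, {subset S i <= S i.+1}) ->
    exists m, forall i, (m <= i)%N -> S i =i S m.

Definition projective P : Prop :=
  forall A B (g : {linear A -> B}) (f : {linear P -> B}),
    surjective g -> exists h : {linear P -> A}, forall x, g (h x) = f x.

Definition injective_module E : Prop :=
  forall A B (g : {linear A -> B}) (f : {linear A -> E}),
    injective g -> exists h : {linear B -> E}, forall x, h (g x) = f x.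

Definition fg_projective P : Prop := finitely_generated P /\ projective P.

(* ... -> X 1 -> X 0 -> M -> 0 exact *)
Record left_resolution M := LeftResolution {
  lres_obj :> nat -> lmodType R;
  lres_d : forall i, {linear lres_obj i.+1 -> lres_obj i};
  lres_aug : {linear lres_obj 0 -> M};
  _ : surjective lres_aug;
  _ : exact (lres_d 0) lres_aug;
  _ : forall i, exact (lres_d i.+1) (lres_d i)
}.

Definition essential A B (f : {linear A -> B}) : Prop :=
  forall S : {pred B}, submod_closed S ->
    (forall x, f x \in S -> f x = 0) -> forall y, y \in S -> y = 0.

(* 0 -> M -> I 0 -> I 1 -> ... exact with every [I i] injective, [I 0] being an
   essential extension of the image of M and [I i.+1] of the image of [I i];
   thus [I 0] is an injective envelope of M and [I i.+1] one of the cokernel of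
   the map arriving at [I i]. *)
Record min_injective_resolution M := MinInjectiveResolution {
  ires_obj :> nat -> lmodType R;
  ires_aug : {linear M -> ires_obj 0};
  ires_d : forall i, {linear ires_obj i -> ires_obj i.+1};
  _ : injective ires_aug;
  _ : exact ires_aug (ires_d 0);
  _ : forall i, exact (ires_d i) (ires_d i.+1);
  _ : forall i, injective_module (ires_obj i);
  _ : essential ires_aug;
  _ : forall i, essential (ires_d i)
}.

Definition balanced (X : lmodType R^c) M (T : zmodType) (b : X -> M -> T) : Prop :=
  [/\ forall x y m, b (x + y) m = b x m + b y m,
      forall x m n, b x (m + n) = b x m + b x n
    & forall x (r : R) m, b ((r : R^c) *: x) m = b x (r *: m)].

Definition is_tensor (X : lmodType R^c) M (T : zmodType) (t : X -> M -> T) : Prop :=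
  balanced t /\
  forall (Z : zmodType) (b : X -> M -> Z), balanced b ->
    (exists u : {additive T -> Z}, forall x m, u (t x m) = b x m) /\
    (forall u v : {additive T -> Z},
        (forall x m, u (t x m) = v (t x m)) -> u =1 v).

Definition flat M : Prop :=
  forall (X Y : lmodType R^c) (f : {linear X -> Y}), injective f ->
  forall (T U : zmodType) (t : X -> M -> T) (u : Y -> M -> U),
    is_tensor t -> is_tensor u ->
  forall fM : {additive T -> U},
    (forall x m, fM (t x m) = u (f x) m) -> injective fM.

(* fd M <= m *)
Definition fd_le M (m : nat) : Prop :=
  exists F : left_resolution M,
    (forall i, flat (F i)) /\ (forall i, (m < i)%N -> zero_module (F i)).

(* Ext^i_R(M, N) = 0, as the vanishing of the i-th cohomology of Hom(P, N) for
   a projective resolution P of M. *)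
Definition Hom_cocycle M N (P : left_resolution M) i (f : {linear P i -> N}) : Prop :=
  forall x, f (lres_d P i x) = 0.

Definition Hom_coboundary M N (P : left_resolution M) i :
    {linear P i -> N} -> Prop :=
  match i with
  | 0 => fun f => forall x, f x = 0
  | j.+1 => fun f => exists g : {linear P j -> N}, forall x, f x = g (lres_d P j x)
  end.

Definition Ext_zero i M N : Prop :=
  forall P : left_resolution M, (forall j, projective (P j)) ->
  forall f : {linear P i -> N}, Hom_cocycle f -> Hom_coboundary f.

(* There is an exact sequence 0 -> M -> P_(n-1) -> ... -> P_0 -> A -> 0, which
   is encoded as a resolution X of A with X_i = P_i for i < n, X_n = M, and
   X_i = 0 for i > n. *)
Definition syzygy_module n M : Prop :=
  finitely_generated M /\
  exists (A : lmodType R) (X : left_resolution A),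
    [/\ finitely_generated A,
        forall i, (i < n)%N -> fg_projective (X i),
        isomorphic M (X n)
      & forall i, (n < i)%N -> zero_module (X i)].

End Modules.

Section Dual.
Variables (R : pzRingType) (M : lmodType R).

Definition dual : Type := {linear M -> R^o}.

HB.instance Definition _ := gen_eqMixin dual.
HB.instance Definition _ := gen_choiceMixin dual.

Lemma dual_ext (f g : {linear M -> R^o}) : f =1 g -> f = g :> dual.
Proof.
case: f g => [f [[f0] [fZ]]] [g [[g0] [gZ]]] /= /funext fg.
case: _ / fg g0 gZ => g0 gZ.
by rewrite (Prop_irrelevance f0 g0) (Prop_irrelevance fZ gZ).
Qed.

Definition dual_zero : dual := \0 : {linear M -> R^o}.
Definition dual_opp (f : {linear M -> R^o}) : dual := \- f : {linear M -> R^o}.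
Definition dual_add (f g : {linear M -> R^o}) : dual := f \+ g : {linear M -> R^o}.

Lemma dual_addA : associative (dual_add : dual -> dual -> dual).
Proof. by move=> f g h; apply: dual_ext => x; exact: addrA. Qed.
Lemma dual_addC : commutative (dual_add : dual -> dual -> dual).
Proof. by move=> f g; apply: dual_ext => x; exact: addrC. Qed.
Lemma dual_add0 : left_id dual_zero (dual_add : dual -> dual -> dual).
Proof. by move=> f; apply: dual_ext => x; exact: add0r. Qed.
Lemma dual_addN : left_inverse dual_zero dual_opp (dual_add : dual -> dual -> dual).
Proof. by move=> f; apply: dual_ext => x; exact: addNr. Qed.

HB.instance Definition _ :=
  GRing.isZmodule.Build dual dual_addA dual_addC dual_add0 dual_addN.

(* (f r)(x) = f(x) r *)
Definition dual_scale_fun (r : R) (f : {linear M -> R^o}) (x : M) : R^o :=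
  (f x : R) * r.

Lemma dual_scale_linear r f : linear (dual_scale_fun r f).
Proof.
by move=> a x y; rewrite /dual_scale_fun linearP mulrDl -[a *: f x]/(a * f x) -mulrA.
Qed.

HB.instance Definition _ r f :=
  GRing.isLinear.Build R M R^o *:%R (dual_scale_fun r f) (dual_scale_linear r f).

Definition dual_scale (r : R^c) (f : {linear M -> R^o}) : dual :=
  dual_scale_fun r f : {linear M -> R^o}.

Lemma dual_scaleA (r s : R^c) (f : dual) :
  dual_scale r (dual_scale s f) = dual_scale (r * s) f.
Proof. by apply: dual_ext => x; rewrite /= /dual_scale_fun -mulrA. Qed.
Lemma dual_scale1 : left_id 1 (dual_scale : R^c -> dual -> dual).
Proof. by move=> f; apply: dual_ext => x; exact: mulr1. Qed.
Lemma dual_scaleDr : right_distributive (dual_scale : R^c -> dual -> dual) +%R.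
Proof. by move=> r f g; apply: dual_ext => x; exact: mulrDl. Qed.
Lemma dual_scaleDl (f : dual) :
  {morph (fun r => dual_scale r f) : r s / r + s}.
Proof. by move=> r s; apply: dual_ext => x; exact: mulrDr. Qed.

HB.instance Definition _ := GRing.Zmodule_isLmodule.Build R^c dual
  dual_scaleA dual_scale1 dual_scaleDr dual_scaleDl.

End Dual.

Section DualMap.
Variables (R : pzRingType) (A B : lmodType R) (f : {linear A -> B}).

Definition dual_map (g : dual B) : dual A :=
  (g : {linear B -> R^o}) \o f : {linear A -> R^o}.

Lemma dual_map_linear : linear dual_map.
Proof. by move=> r g h; apply: dual_ext. Qed.

HB.instance Definition _ :=
  GRing.isLinear.Build R^c (dual B) (dual A) *:%R dual_map dual_map_linear.

End DualMap.

Section Gorenstein.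
Variable R : pzRingType.
Implicit Types M : lmodType R.

Definition left_noetherian : Prop := noetherian_module R^o.
Definition right_noetherian : Prop := noetherian_module R^c^o.

(* T is an Auslander transpose of M: the cokernel of P0^* -> P1^* for a finitely
   generated projective presentation P1 -> P0 -> M -> 0. *)
Definition is_transpose M (T : lmodType R^c) : Prop :=
  exists (P1 P0 : lmodType R) (f : {linear P1 -> P0}) (p : {linear P0 -> M})
         (q : {linear dual P1 -> T}),
    [/\ fg_projective P1 /\ fg_projective P0,
        surjective p, exact f p,
        surjective q & exact (dual_map f : {linear dual P0 -> dual P1}) q].

Definition Gorenstein_dim_zero M : Prop :=
  [/\ finitely_generated M,
      forall i, (1 <= i)%N -> Ext_zero i M R^o
    & forall T, is_transpose M T -> forall i, (1 <= i)%N -> Ext_zero i T R^c^o].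

(* fd I_i(M) <= i + k for 0 <= i <= n - 1 *)
Definition fd_inj_le n k M : Prop :=
  forall (I : min_injective_resolution M) i, (i < n)%N -> fd_le (I i) (i + k).

(* R is G_n(k)^op: the condition bears on R as a left module. *)
Definition G_op n k : Prop := fd_inj_le n k R^o.

End Gorenstein.

(* Main.v *)
Require Import Defs.
From HB Require Import structures.
From mathcomp Require Import all_boot all_algebra.
From mathcomp Require Import boolp classical_sets.

(** A bound on the minimal injective resolution of [M] amounts to the same bound
    on some injective coresolution of [M] ([fd_inj_leP]): the terms of the minimal
    one are direct factors of the terms of any other ([cores_le_min]), and flat
    dimension passes to direct factors.  In this form the condition is stable
    under extensions, by the horseshoe lemma ([cores_le_extension]), and under
    direct factors, so that it passes from [R] to every finitely generated
    projective module.

    Let [0 -> A -> P -> K -> 0] be exact, let [E] be the first term for [P].  Then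
    [E / A] is an extension of [E / P] by [K]; so the bounds for [n + 1] terms on
    [P] and for [n] terms on [K] give the bounds for [n + 1] terms on [A]
    ([cores_le_syzygy]).  Climbing the sequence that makes [A] an [n]-syzygy, one
    passes from [R] to [A].  As [R] itself is an [n]-syzygy and has Gorenstein
    dimension zero, it remains to see that a module [G] of Gorenstein dimension
    zero is an [n]-syzygy ([Gorenstein_syzygy_module]): dualizing a resolution of
    [Tr G] by finitely generated projective modules gives a coresolution of [G],
    exact because [Ext^i(Tr G, R) = 0].

    Two supporting theories are needed.  Flat dimension is handled through the
    character module [M^+ = Hom_Z(M, Q/Z)]: [M] is flat if and only if [M^+] is
    injective ([flat_char]), so the flat dimension of [M] is the injective
    dimension of [M^+] ([fd_le_char]), and Schanuel's lemma for injective modules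
    ([cosyzygy_retract]) shows that it passes to direct factors.  Characters also
    provide enough injective modules, from which injective envelopes, and hence
    minimal resolutions, are obtained by taking complements
    ([injective_envelope]). *)

Set Implicit Arguments.
Unset Strict Implicit.
Unset Printing Implicit Defensive.

Import GRing.Theory Num.Theory.
Local Open Scope ring_scope.


(** * Linear maps *)

Section LinearMaps.
Variable R : pzRingType.

Definition lin (A B : lmodType R) (f : A -> B) (f_lin : linear f) :
    {linear A -> B} :=
  HB.pack f (GRing.isLinear.Build R A B *:%R f f_lin).

Lemma factor_through_surjection (A B C : lmodType R)
    (q : {linear A -> B}) (f : {linear A -> C}) :
  surjective q -> (forall x, q x = 0 -> f x = 0) ->
  exists h : {linear B -> C}, forall x, h (q x) = f x.
Proof.
move=> q_surj kerqf; have [s qs] := choice q_surj.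
have fP x y : q x = q y -> f x = f y.
  by move=> qxy; apply/eqP; rewrite -subr_eq0 -linearB; apply/eqP/kerqf;
     rewrite linearB qxy subrr.
have h_lin : linear (fun y => f (s y)).
  by move=> a x y; rewrite -linearP; apply: fP; rewrite linearP !qs.
by exists (lin h_lin) => x /=; apply: fP; rewrite qs.
Qed.

Lemma factor_through_injection (A B C : lmodType R)
    (i : {linear A -> B}) (f : {linear C -> B}) :
  injective i -> (forall x, exists y, i y = f x) ->
  exists h : {linear C -> A}, forall x, i (h x) = f x.
Proof.
move=> i_inj /choice [s si].
have h_lin : linear s by move=> a x y; apply: i_inj; rewrite linearP !si linearP.
by exists (lin h_lin).
Qed.

Lemma kernel_injective (A B : lmodType R) (f : {linear A -> B}) :
  (forall x, f x = 0 -> x = 0) -> injective f.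
Proof.
move=> kerf x y fxy; apply/eqP; rewrite -subr_eq0; apply/eqP/kerf.
by rewrite linearB fxy subrr.
Qed.

Lemma injective_kernel (A B : lmodType R) (f : {linear A -> B}) x :
  injective f -> f x = 0 -> x = 0.
Proof. by move=> f_inj fx0; apply: f_inj; rewrite linear0. Qed.

Definition short_exact (A B C : lmodType R)
    (i : {linear A -> B}) (p : {linear B -> C}) : Prop :=
  [/\ injective i, surjective p & exact i p].

Definition retract (M N : lmodType R) : Prop :=
  exists (s : {linear M -> N}) (p : {linear N -> M}), forall x, p (s x) = x.

Definition submodule (M : lmodType R) (S : M -> Prop) : Prop :=
  S 0 /\ forall a x y, S x -> S y -> S (a *: x + y).

Section Submodule.
Variables (M : lmodType R) (S : M -> Prop) (S_sub : submodule S).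

Lemma submodule0 : S 0. Proof. by case: S_sub. Qed.
Lemma submoduleZ a x : S x -> S (a *: x).
Proof.
by case: S_sub => S0 SP Sx; rewrite -[_ *: _]addr0; apply: SP.
Qed.
Lemma submoduleD x y : S x -> S y -> S (x + y).
Proof. by case: S_sub => S0 SP Sx Sy; rewrite -[x]scale1r; apply: SP. Qed.
Lemma submoduleN x : S x -> S (- x).
Proof. by rewrite -scaleN1r; apply: submoduleZ. Qed.
Lemma submoduleB x y : S x -> S y -> S (x - y).
Proof. by move=> Sx /submoduleN; apply: submoduleD. Qed.

End Submodule.

Lemma kernel_submodule (A B : lmodType R) (f : {linear A -> B}) :
  submodule (fun x => f x = 0).
Proof.
split=> [|a x y fx fy]; first exact: linear0.
by rewrite linearP fx fy scaler0 addr0.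
Qed.

Lemma image_submodule (A B : lmodType R) (f : {linear A -> B}) :
  submodule (fun y => exists x, f x = y).
Proof.
split=> [|a x y [u <-] [v <-]]; first by exists 0; rewrite linear0.
by exists (a *: u + v); rewrite linearP.
Qed.

End LinearMaps.

(** * Quotients and free modules *)

(** Quotients and free modules are both built as the classes of a type of terms
    for a congruence modulo which the module axioms hold. *)
Record setoid_module (R : pzRingType) := SetoidModule {
  term :> Type;
  eqv : term -> term -> Prop;
  tzero : term;
  tadd : term -> term -> term;
  topp : term -> term;
  tscale : R -> term -> term;
  eqv_refl : forall x, eqv x x;
  eqv_sym : forall x y, eqv x y -> eqv y x;
  eqv_trans : forall y x z, eqv x y -> eqv y z -> eqv x z;
  tadd_eqv : forall x x' y y',
    eqv x x' -> eqv y y' -> eqv (tadd x y) (tadd x' y');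
  topp_eqv : forall x x', eqv x x' -> eqv (topp x) (topp x');
  tscale_eqv : forall a x x', eqv x x' -> eqv (tscale a x) (tscale a x');
  taddA : forall x y z, eqv (tadd x (tadd y z)) (tadd (tadd x y) z);
  taddC : forall x y, eqv (tadd x y) (tadd y x);
  tadd0 : forall x, eqv (tadd tzero x) x;
  taddN : forall x, eqv (tadd (topp x) x) tzero;
  tscaleA : forall a b x, eqv (tscale a (tscale b x)) (tscale (a * b) x);
  tscale1 : forall x, eqv (tscale 1 x) x;
  tscaleDr : forall a x y,
    eqv (tscale a (tadd x y)) (tadd (tscale a x) (tscale a y));
  tscaleDl : forall a b x,
    eqv (tscale (a + b) x) (tadd (tscale a x) (tscale b x))
}.

Section ClassModule.
Variables (R : pzRingType) (X : setoid_module R).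

Definition classes : Type := {A : X -> Prop | exists x, A = eqv x}.

HB.instance Definition _ := gen_eqMixin classes.
HB.instance Definition _ := gen_choiceMixin classes.

Definition class_of (x : X) : classes := exist _ (eqv x) (ex_intro _ x erefl).
Definition class_repr (c : classes) : X := sval (cid (svalP c)).

Lemma class_of_eq x y : class_of x = class_of y <-> eqv x y.
Proof.
split=> [[exy]|exy]; first by rewrite exy; apply: eqv_refl.
apply: eq_exist => /=; apply/funext => z; apply/propext; split=> [exz|eyz].
  by apply: eqv_trans exz; apply: eqv_sym.
exact: eqv_trans eyz.
Qed.

Lemma class_reprK c : class_of (class_repr c) = c.
Proof.
rewrite /class_repr; case: cid => x /= cE; case: c cE => A Ax /= AE.
by apply: eq_exist.
Qed.

Lemma class_repr_of x : eqv (class_repr (class_of x)) x.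
Proof. by apply/class_of_eq; rewrite class_reprK. Qed.

Definition class_add c d := class_of (tadd (class_repr c) (class_repr d)).
Definition class_opp c := class_of (topp (class_repr c)).
Definition class_scale a c := class_of (tscale a (class_repr c)).

Lemma class_addE x y :
  class_add (class_of x) (class_of y) = class_of (tadd x y).
Proof. by apply/class_of_eq; apply: tadd_eqv; apply: class_repr_of. Qed.
Lemma class_oppE x : class_opp (class_of x) = class_of (topp x).
Proof. by apply/class_of_eq; apply: topp_eqv; apply: class_repr_of. Qed.
Lemma class_scaleE a x : class_scale a (class_of x) = class_of (tscale a x).
Proof. by apply/class_of_eq; apply: tscale_eqv; apply: class_repr_of. Qed.

Lemma class_addA : associative class_add.
Proof.
move=> x y z; rewrite -(class_reprK x) -(class_reprK y) -(class_reprK z).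
by rewrite !class_addE; apply/class_of_eq/taddA.
Qed.
Lemma class_addC : commutative class_add.
Proof.
move=> x y; rewrite -(class_reprK x) -(class_reprK y) !class_addE.
exact/class_of_eq/taddC.
Qed.
Lemma class_add0 : left_id (class_of (tzero X)) class_add.
Proof.
by move=> x; rewrite -(class_reprK x) !class_addE; apply/class_of_eq/tadd0.
Qed.
Lemma class_addN : left_inverse (class_of (tzero X)) class_opp class_add.
Proof.
move=> x; rewrite -(class_reprK x) class_oppE class_addE.
exact/class_of_eq/taddN.
Qed.

HB.instance Definition _ := GRing.isZmodule.Build classes
  class_addA class_addC class_add0 class_addN.

Lemma class_scaleA a b x :
  class_scale a (class_scale b x) = class_scale (a * b) x.
Proof.
rewrite -(class_reprK x) !class_scaleE; exact/class_of_eq/tscaleA.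
Qed.
Lemma class_scale1 : left_id 1 class_scale.
Proof.
by move=> x; rewrite -(class_reprK x) class_scaleE; apply/class_of_eq/tscale1.
Qed.
Lemma class_scaleDr : right_distributive class_scale class_add.
Proof.
move=> a x y; rewrite -(class_reprK x) -(class_reprK y).
by rewrite !(class_addE, class_scaleE); apply/class_of_eq/tscaleDr.
Qed.
Lemma class_scaleDl x : {morph class_scale^~ x : a b / a + b >-> class_add a b}.
Proof.
move=> a b; rewrite -(class_reprK x) !(class_addE, class_scaleE).
exact/class_of_eq/tscaleDl.
Qed.

HB.instance Definition _ := GRing.Zmodule_isLmodule.Build R classes
  class_scaleA class_scale1 class_scaleDr class_scaleDl.

Lemma class_ofD x y : class_of (tadd x y) = class_of x + class_of y.
Proof. by rewrite -class_addE. Qed.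
Lemma class_ofZ a x : class_of (tscale a x) = a *: class_of x.
Proof. by rewrite -class_scaleE. Qed.
Lemma class_of0 : class_of (tzero X) = 0. Proof. by []. Qed.

End ClassModule.

Lemma quotient_module (R : pzRingType) (M : lmodType R) (S : M -> Prop) :
  submodule S ->
  exists (Q : lmodType R) (q : {linear M -> Q}),
    surjective q /\ forall x, q x = 0 <-> S x.
Proof.
move=> S_sub; have S0 := submodule0 S_sub.
have eqvS x y : x = y -> S (x - y) by move=> ->; rewrite subrr.
unshelve epose (X := @SetoidModule R M (fun x y => S (x - y)) 0 +%R -%R *:%R
  _ _ _ _ _ _ _ _ _ _ _ _ _ _); move=> /=.
- by move=> x; apply: eqvS.
- by move=> x y /(submoduleN S_sub); rewrite opprB.
- by move=> y x z Sxy /(submoduleD S_sub Sxy); rewrite addrA subrK.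
- by move=> x x' y y' Sx /(submoduleD S_sub Sx); rewrite opprD addrACA.
- by move=> x x' /(submoduleN S_sub); rewrite opprD.
- by move=> a x x' /(submoduleZ S_sub a); rewrite scalerBr.
- by move=> x y z; apply/eqvS/addrA.
- by move=> x y; apply/eqvS/addrC.
- by move=> x; apply/eqvS/add0r.
- by move=> x; apply/eqvS/addNr.
- by move=> a b x; apply/eqvS/scalerA.
- by move=> x; apply/eqvS/scale1r.
- by move=> a x y; apply/eqvS/scalerDr.
- by move=> a b x; apply/eqvS/scalerDl.
have q_lin : linear (@class_of R X : M -> classes X).
  by move=> a x y; rewrite -class_ofZ -class_ofD.
exists (classes X), (lin q_lin); split=> [c|x /=].
  by exists (class_repr c); apply: class_reprK.
by rewrite -class_of0 class_of_eq /= subr0.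
Qed.

Section FreeModule.
Variables (R : pzRingType) (S : Type).

Definition eval_term (N : lmodType R) (phi : S -> N) (t : seq (R * S)) : N :=
  \sum_(c <- t) c.1 *: phi c.2.

(** Formal combinations are identified when every map into a module gives them
    the same value, which makes the universal property immediate. *)
Lemma free_module :
  exists (F : lmodType R) (e : S -> F), forall (N : lmodType R) (phi : S -> N),
    (exists h : {linear F -> N}, forall s, h (e s) = phi s) /\
    (forall h h' : {linear F -> N}, (forall s, h (e s) = h' (e s)) -> h =1 h').
Proof.
pose E N := @eval_term N.
pose topp' (t : seq (R * S)) := [seq (- c.1, c.2) | c <- t].
pose tscale' a (t : seq (R * S)) := [seq (a * c.1, c.2) | c <- t].
have Ecat N phi t u : E N phi (t ++ u) = E N phi t + E N phi u.
  by rewrite /E /eval_term big_cat.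
have Eopp N phi t : E N phi (topp' t) = - E N phi t.
  rewrite /E /eval_term big_map -sumrN.
  by apply: eq_bigr => c _; rewrite scaleNr.
have Escale N phi a t : E N phi (tscale' a t) = a *: E N phi t.
  rewrite /E /eval_term big_map scaler_sumr.
  by apply: eq_bigr => c _; rewrite scalerA.
have Enil N phi : E N phi [::] = 0 by rewrite /E /eval_term big_nil.
unshelve epose (X := @SetoidModule R (seq (R * S))
  (fun t u => forall N phi, E N phi t = E N phi u) [::] cat topp' tscale'
  _ _ _ _ _ _ _ _ _ _ _ _ _ _); move=> /=.
- by [].
- by move=> x y xy N phi.
- by move=> y x z xy yz N phi; rewrite xy.
- by move=> x x' y y' xx' yy' N phi; rewrite !Ecat xx' yy'.
- by move=> x x' xx' N phi; rewrite !Eopp xx'.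
- by move=> a x x' xx' N phi; rewrite !Escale xx'.
- by move=> x y z N phi; rewrite !Ecat addrA.
- by move=> x y N phi; rewrite !Ecat addrC.
- by [].
- by move=> x N phi; rewrite Ecat Eopp addNr Enil.
- by move=> a b x N phi; rewrite !Escale scalerA.
- by move=> x N phi; rewrite Escale scale1r.
- by move=> a x y N phi; rewrite !(Escale, Ecat) scalerDr.
- by move=> a b x N phi; rewrite !(Escale, Ecat) scalerDl.
pose e s : classes X := @class_of R X [:: (1, s)].
have classE (t : X) : class_of t = \sum_(c <- t) c.1 *: e c.2.
  elim: t => [|c t IHt]; first by rewrite big_nil.
  rewrite big_cons -IHt -class_ofZ -class_ofD; apply/class_of_eq => N phi.
  by rewrite /= !mulr1; case: c.
exists (classes X), e => N phi; split=> [|h h' hh' x].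
  have repr_of (t : X) : E N phi (class_repr (class_of t)) = E N phi t.
    exact: (@class_repr_of R X t N phi).
  have h_lin : linear (fun c : classes X => E N phi (class_repr c)).
    move=> a x y; rewrite -Escale -Ecat -[RHS]repr_of.
    by rewrite [class_of _]class_ofD [class_of _]class_ofZ !class_reprK.
  exists (lin h_lin) => s.
  by rewrite /= repr_of /E /eval_term big_seq1 scale1r.
rewrite -(class_reprK x) classE !linear_sum.
by apply: eq_bigr => c _; rewrite !linearZ hh'.
Qed.

End FreeModule.

Lemma enough_projectives (R : pzRingType) (M : lmodType R) :
  exists (P : lmodType R) (p : {linear P -> M}), projective P /\ surjective p.
Proof.
have [F [e eP]] := free_module R M; have [[p pe] _] := eP M id.
exists F, p; split; last by move=> m; exists (e m).
move=> A B g f g_surj; have [s gs] := choice g_surj.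
have [[h he] _] := eP A (fun m => s (f (e m))).
exists h => x; have [_ uniq_e] := eP B (fun m => f (e m)).
rewrite -[LHS]/((g \o h : {linear F -> B}) x).
by apply: uniq_e => m /=; rewrite he gs.
Qed.

Lemma image_factorization (R : pzRingType) (A B : lmodType R)
    (f : {linear A -> B}) :
  exists (I : lmodType R) (q : {linear A -> I}) (i : {linear I -> B}),
    [/\ surjective q, injective i & forall x, i (q x) = f x].
Proof.
have [I [q [q_surj kerq]]] := quotient_module (kernel_submodule f).
have [|i iq] := @factor_through_surjection _ _ _ _ q f q_surj.
  by move=> x /kerq.
exists I, q, i; split=> //; apply: kernel_injective => y.
by have [x <-] := q_surj y; rewrite iq => /kerq.
Qed.

(** The submodule is an image of the free module on its elements, so that
    quotients are the only carriers to be constructed. *)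
Lemma submodule_carrier (R : pzRingType) (M : lmodType R) (S : M -> Prop) :
  submodule S ->
  exists (K : lmodType R) (i : {linear K -> M}),
    injective i /\ forall x, S x <-> exists y, i y = x.
Proof.
move=> S_sub; have [Q [q [q_surj kerq]]] := quotient_module S_sub.
have [F [e eP]] := free_module R {x | S x}; have [[p pe] _] := eP M sval.
have [K [r [i [r_surj i_inj ir]]]] := image_factorization p.
exists K, i; split=> // x; split=> [Sx|[y <-]].
  by exists (r (e (exist _ x Sx))); rewrite ir pe.
have [z <-] := r_surj y; rewrite ir; apply/kerq.
have [_ uniq_e] := eP Q (fun=> 0).
rewrite -[LHS]/((q \o p : {linear F -> Q}) z).
rewrite -[RHS]/((\0 : {linear F -> Q}) z).
by apply: uniq_e => -[t St] /=; rewrite pe; apply/kerq.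
Qed.

Lemma cokernel (R : pzRingType) (A B : lmodType R) (f : {linear A -> B}) :
  exists (C : lmodType R) (q : {linear B -> C}), surjective q /\ exact f q.
Proof.
have [C [q [q_surj kerq]]] := quotient_module (image_submodule f).
by exists C, q; split.
Qed.

Lemma kernel (R : pzRingType) (A B : lmodType R) (f : {linear A -> B}) :
  exists (K : lmodType R) (i : {linear K -> A}), injective i /\ exact i f.
Proof.
have [K [i [i_inj iP]]] := submodule_carrier (kernel_submodule f).
by exists K, i; split=> // x; rewrite iP.
Qed.


(** * Complements *)

Section Complement.
Variables (R : pzRingType) (M : lmodType R).

Definition disjoint_from (N S : M -> Prop) : Prop :=
  forall x, N x -> S x -> x = 0.

(** By Zorn's lemma, for unions of chains.  Graphs of partial maps are submodules
    disjoint from the second factor, so this also extends morphisms. *)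
Lemma maximal_disjoint (N S0 : M -> Prop) :
  submodule S0 -> disjoint_from N S0 ->
  exists S : M -> Prop,
    [/\ submodule S, forall x, S0 x -> S x, disjoint_from N S
      & forall S' : M -> Prop, submodule S' -> (forall x, S x -> S' x) ->
          disjoint_from N S' -> forall x, S' x -> S x].
Proof.
move=> S0_sub NS0.
pose good (S : set M) :=
  [/\ submodule S, forall x, S0 x -> S x & disjoint_from N S].
(* The empty set is admitted because it is the union of the empty chain. *)
have [|A [A_ok A_max]] := @Zorn_bigcup M (fun S => S = set0 \/ good S).
  move=> F FP F_tot.
  have Fgood X x : F X -> X x -> good X.
    by move=> FX Xx; case: (FP _ FX) => // X0; rewrite X0 in Xx.
  have [[X FX [X_sub S0X NX]]|none] := EM (exists2 X, F X & good X); last first.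
    by left; apply/seteqP; split=> // x [X FX Xx]; apply: none; exists X;
       [|apply: Fgood Xx].
  right; split=> [|x S0x|x Nx [Y FY Yx]]; last 1 first.
  - by have [_ _ NY] := Fgood _ _ FY Yx; apply: NY.
  - split=> [|a x y [Y FY Yx] [Z FZ Zy]].
      by exists X => //; apply: submodule0 X_sub.
    have [Y_sub _ _] := Fgood _ _ FY Yx; have [Z_sub _ _] := Fgood _ _ FZ Zy.
    by have [/(_ _ Yx) Zx|/(_ _ Zy) Yy] := F_tot _ _ FY FZ;
       [exists Z | exists Y] => //; [apply: Z_sub.2 | apply: Y_sub.2].
  - by exists X => //; apply: S0X.
have A_good : good A.
  case: A_ok => // A0; exfalso; apply: (A_max S0); last by right; split.
  split; first by rewrite A0.
  by move=> /(_ 0 (submodule0 S0_sub)); rewrite A0.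
case: (A_good) => A_sub S0A NA; exists A; split=> // S' S'_sub AS' NS' x S'x.
apply: contrapT => nAx; apply: (A_max S').
  by split=> [|/(_ x S'x)]; [apply: AS'|].
by right; split=> // y /S0A/AS'.
Qed.

End Complement.

(** * The character group *)

(** A maximal functional graph containing [G] is total: the values which it
    imposes on the multiples of a point [b] all follow from the one at the least
    positive multiple in its domain (if any), and dividing this one gives a value
    at [b]. *)
Lemma extend_partial_morphism (B D : zmodType) (G : B -> D -> Prop) :
  (forall n (d : D), (0 < n)%N -> exists d', d' *+ n = d) ->
  G 0 0 -> (forall x x' y y', G x y -> G x' y' -> G (x - x') (y - y')) ->
  (forall y, G 0 y -> y = 0) ->
  exists h : {additive B -> D}, forall x y, G x y -> h x = y.
Proof.
move=> D_div G0 GB Gfun.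
pose M : lmodType int := (zmodule B * zmodule D)%type.
have scaleE (a : int) (z : M) : a *: z = (z.1 *~ a, z.2 *~ a).
  by [].
have [||S [S_sub GS Sfun S_max]] :=
    @maximal_disjoint int M (fun z => z.1 = 0) (fun z => G z.1 z.2).
- have GN x y : G x y -> G (- x) (- y).
    by move=> /(GB _ _ _ _ G0); rewrite !sub0r.
  have GD x x' y y' : G x y -> G x' y' -> G (x + x') (y + y').
    by move=> Gxy /GN /(GB _ _ _ _ Gxy); rewrite !opprK.
  have Gn x y n : G x y -> G (x *+ n) (y *+ n).
    by move=> Gxy; elim: n => // n IHn; rewrite !mulrS; apply: GD.
  split=> // a x y Gx Gy; rewrite scaleE; apply: GD => //=.
  by case: a => n; [|apply: GN]; apply: Gn.
- by move=> [b d] /= -> /Gfun ->.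
have SE b d : S (b, d) -> b = 0 -> d = 0.
  by move=> Sbd b0; apply: (congr1 snd (@Sfun (b, d) b0 Sbd)).
have S_total b : exists d, S (b, d).
  have [d dP] : exists d : D, forall k y, S (b *~ k, y) -> y = d *~ k.
    have [[n /andP[n_gt0 /asboolP[e Sne]] n_min]|none] := EM (exists2 n,
        (0 < n)%N && `[< exists e, S (b *+ n, e) >] & forall m,
        (0 < m)%N && `[< exists e, S (b *+ m, e) >] -> (n <= m)%N).
      have [d dn] := D_div n e n_gt0; exists d => k y Sky.
      have n0 : (n%:Z != 0) by rewrite eqz_nat -lt0n.
      have [r r_def] : exists r : nat, (k %% n)%Z = r.
        by exists `|(k %% n)%Z|%N; rewrite gez0_abs // modz_ge0.
      have r_lt : (r < n)%N by rewrite -ltz_nat -r_def ltz_pmod.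
      have kE : k = (k %/ n)%Z * n + r by rewrite -r_def -divz_eq.
      have Sr : S (b *+ r, y - e *~ (k %/ n)%Z).
        have := submoduleB S_sub Sky (submoduleZ S_sub (k %/ n)%Z Sne).
        rewrite scaleE /= {1}kE; congr S; congr pair.
        rewrite /= mulrzDr [_ * Posz n]mulrC mulrzA -!pmulrn. by rewrite addrAC subrr add0r.
      have r0 : r = 0%N.
        apply/eqP; rewrite -leqn0 leqNgt; apply/negP => r_gt0.
        have /n_min : (0 < r)%N && `[< exists e, S (b *+ r, e) >].
          by rewrite r_gt0; apply/asboolP; exists (y - e *~ (k %/ n)%Z).
        by rewrite leqNgt r_lt.
      have /eqP := SE _ _ Sr ltac:(by rewrite r0); rewrite subr_eq0 => /eqP ->.
      by rewrite {2}kE r0 addr0 mulrC mulrzA -dn.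
    exists 0 => k y Sky; rewrite mul0rz.
    have [k0|k0] := eqVneq k 0; first by rewrite k0 in Sky; apply: SE Sky _.
    exfalso; apply: none.
    pose Q m := (0 < m)%N && `[< exists e, S (b *+ m, e) >].
    have Q_ex : exists m, Q m.
      exists `|k|%N; rewrite /Q absz_gt0 k0; apply/asboolP.
      have := submoduleZ S_sub (sgz k) Sky; rewrite scaleE /= -mulrzA.
      by rewrite mulrC -abszEsg; exists (y *~ sgz k).
    by case: (ex_minnP Q_ex) => m Qm m_min; exists m.
  exists d; pose bd : M := (b, d).
  apply: (S_max (fun z => exists k w, S w /\ z = w + k *: bd)).
  - split=> [|a x y [k [w [Sw ->]]] [l [v [Sv ->]]]].
      by exists 0, 0; rewrite scale0r addr0; split=> //; apply: submodule0.
    exists (a * k + l), (a *: w + v); split; first exact: S_sub.2.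
    by rewrite scalerDr scalerDl addrACA scalerA.
  - by move=> w Sw; exists 0, w; rewrite scale0r addr0.
  - move=> z z0 [k [[x y] [Sxy zE]]]; rewrite zE scaleE /= in z0 *.
    have := submoduleN S_sub Sxy; rewrite -[- _]/(- x, - y).
    have -> : - x = b *~ k by apply/eqP; rewrite eq_sym -addr_eq0 addrC z0.
    move=> /dP yE; have yk := etrans (congr1 (+%R y) (esym yE)) (subrr y).
    by congr pair.
  - by exists 1, 0; rewrite scale1r add0r; split=> //; apply: submodule0.
have [h hS] := choice S_total.
have h_fun x y : S (x, y) -> h x = y.
  move=> Sxy; apply/eqP; rewrite -subr_eq0; apply/eqP.
  by apply: SE (submoduleB S_sub (hS x) Sxy) _; rewrite subrr.
have h_add : zmod_morphism h.
  by move=> x y; apply: h_fun; apply: (submoduleB S_sub (hS x) (hS y)).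
pose H := HB.pack_for {additive B -> D} h (GRing.isZmodMorphism.Build B D h h_add).
by exists H => x y Gxy; apply: h_fun; apply: GS.
Qed.

(** The rationals modulo the integers: divisibility gives the extension of
    morphisms, and the existence of elements of every order gives a nonzero
    character on every nonzero cyclic group. *)
Lemma character_target : exists D : zmodType,
  (forall (A B : zmodType) (g : {additive A -> B}) (f : {additive A -> D}),
     injective g -> exists h : {additive B -> D}, forall x, h (g x) = f x) /\
  (forall (A : zmodType) (a : A), a != 0 ->
     exists h : {additive A -> D}, h a != 0).
Proof.
have [|D [q [q_surj kerq]]] :=
    @quotient_module int (zmodule rat) (fun x => exists k : int, x = k%:~R).
  split=> [|a x y [k ->] [l ->]]; first by exists 0.
  by exists (a * k + l); rewrite scalezrE -mulrzr -intrM -intrD mulrC.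
have D_div n (d : D) : (0 < n)%N -> exists d', d' *+ n = d.
  move=> n_gt0; have [x <-] := q_surj d.
  have xn : ((x : rat) / n%:R) *+ n = x.
    by rewrite -[LHS]mulr_natr divfK // pnatr_eq0 -lt0n.
  by exists (q ((x : rat) / n%:R)); rewrite -raddfMn [_ *+ n]xn.
have D_inv n : (1 < n)%N -> exists2 d : D, d != 0 & d *+ n = 0.
  move=> n_gt1; have n_gt0 := ltnW n_gt1.
  exists (q (n%:R^-1 : rat)).
    apply/eqP => /kerq [k kE].
    have : (n%:Z * k)%:~R = 1 :> rat.
      by rewrite intrM -kE mulfV // pnatr_eq0 -lt0n.
    move=> /eqP; rewrite -[1]/(1%:~R) eqr_int => /eqP /(congr1 absz).
    rewrite abszM /= => /eqP; rewrite muln_eq1 => /andP[/eqP n1 _].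
    by rewrite n1 in n_gt1.
  rewrite -raddfMn; apply/kerq; exists 1.
  have n1 : (n%:R^-1 : rat) *+ n = 1.
    by rewrite -[LHS]mulr_natr mulVf // pnatr_eq0 -lt0n.
  by rewrite [_ *+ n]n1.
exists D; split=> [A B g f g_inj|A a a0].
  have [|||h hP] :=
    @extend_partial_morphism B D (fun b d => exists a, g a = b /\ f a = d) D_div.
  - by exists 0; rewrite !raddf0.
  - move=> _ _ _ _ [x [<- <-]] [y [<- <-]].
    by exists (x - y); rewrite !raddfB.
  - move=> y [x [gx <-]].
    by have -> : x = 0 by [apply: g_inj; rewrite raddf0]; rewrite raddf0.
  - by exists h => x; apply: hP; exists x.
have [d d0 dP] : exists2 d : D, d != 0 & forall k, a *~ k = 0 -> d *~ k = 0.
  have [[k k0 ak]|none] := EM (exists2 k : int, k != 0 & a *~ k = 0); last first.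
    have [d d0 _] := D_inv 2%N isT; exists d => // k ak.
    have [->|k0] := eqVneq k 0; first by rewrite mulr0z.
    by case: none; exists k.
  pose Q m := (0 < m)%N && (a *+ m == 0).
  have Q_ex : exists m, Q m.
    exists `|k|%N; rewrite /Q absz_gt0 k0 pmulrn abszEsg mulrC mulrzA ak.
    by rewrite mul0rz eqxx.
  case: (ex_minnP Q_ex) => n /andP[n_gt0 /eqP an] n_min.
  have n_gt1 : (1 < n)%N.
    by case: n n_gt0 an {n_min} => [|[|n]] // _ /eqP; rewrite mulr1n (negPf a0).
  have [d d0 dn] := D_inv n n_gt1; exists d => // l al.
  have [r r_def] : exists r : nat, (l %% n)%Z = r.
    by exists `|(l %% n)%Z|%N; rewrite gez0_abs // modz_ge0 // eqz_nat -lt0n.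
  have r_lt : (r < n)%N by rewrite -ltz_nat -r_def ltz_pmod.
  have lE : l = n%:Z * (l %/ n)%Z + r by rewrite -r_def mulrC -divz_eq.
  have ar : a *+ r = 0.
    by move: al; rewrite lE mulrzDr mulrzA -!pmulrn an mul0rz add0r.
  have r0 : r = 0%N.
    apply/eqP; rewrite -leqn0 leqNgt; apply/negP => r_gt0.
    by have := n_min r; rewrite /Q r_gt0 ar eqxx leqNgt r_lt => /(_ isT).
  by rewrite lE r0 addr0 mulrzA -pmulrn dn mul0rz.
have [|||h hP] :=
  @extend_partial_morphism A D (fun x y => exists k, a *~ k = x /\ d *~ k = y) D_div.
- by exists 0; rewrite !mulr0z.
- move=> _ _ _ _ [k [<- <-]] [l [<- <-]].
  by exists (k - l); rewrite !mulrzBr.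
- by move=> y [k [/dP -> <-]].
by exists h; rewrite (hP a d) //; exists 1; rewrite !mulr1z.
Qed.


(** * Character modules *)

Definition QZ : zmodType := sval (cid character_target).

Lemma QZ_injective (A B : zmodType) (g : {additive A -> B})
    (f : {additive A -> QZ}) :
  injective g -> exists h : {additive B -> QZ}, forall x, h (g x) = f x.
Proof. by have [QZ_inj _] := svalP (cid character_target); apply: QZ_inj. Qed.

Lemma QZ_separates (A : zmodType) (a : A) :
  (forall h : {additive A -> QZ}, h a = 0) -> a = 0.
Proof.
move=> a0; apply/eqP; apply: contraT => /(svalP (cid character_target)).2 [h].
by rewrite a0 eqxx.
Qed.

Definition add (A B : zmodType) (f : A -> B) (f_add : zmod_morphism f) :
    {additive A -> B} :=
  HB.pack f (GRing.isZmodMorphism.Build A B f f_add).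

(** Characters of left modules are right modules and conversely; an
    anti-isomorphism of rings covers both sides at once. *)
Record anti_iso (R S : pzRingType) := AntiIso {
  anti : S -> R;
  anti_inv : R -> S;
  antiK : cancel anti anti_inv;
  anti_invK : cancel anti_inv anti;
  anti1 : anti 1 = 1;
  antiM : forall a b, anti (a * b) = anti b * anti a;
  antiD : {morph anti : a b / a + b}
}.

Definition character (R S : pzRingType) (t : anti_iso R S) (M : lmodType R) :
  Type := {additive M -> QZ}.

Section CharacterModule.
Variables (R S : pzRingType) (t : anti_iso R S) (M : lmodType R).
Local Notation char_mod := (character t M).

HB.instance Definition _ := gen_eqMixin char_mod.
HB.instance Definition _ := gen_choiceMixin char_mod.

Lemma char_ext (f g : {additive M -> QZ}) : f =1 g -> f = g :> char_mod.
Proof.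
case: f g => [f [[f0]]] [g [[g0]]] /= /funext fg; case: _ / fg g0 => g0.
by rewrite (Prop_irrelevance f0 g0).
Qed.

Lemma char_scale_additive (a : S) (f : {additive M -> QZ}) :
  zmod_morphism (fun x => f (anti t a *: x)).
Proof. by move=> x y; rewrite scalerBr raddfB. Qed.

Definition char_zero : char_mod := \0 : {additive M -> QZ}.
Definition char_opp (f : {additive M -> QZ}) : char_mod :=
  \- f : {additive M -> QZ}.
Definition char_add (f g : {additive M -> QZ}) : char_mod :=
  f \+ g : {additive M -> QZ}.
Definition char_scale (a : S) (f : {additive M -> QZ}) : char_mod :=
  add (char_scale_additive a f).

Lemma char_addA : associative (char_add : char_mod -> char_mod -> char_mod).
Proof. by move=> f g h; apply: char_ext => x; apply: addrA. Qed.
Lemma char_addC : commutative (char_add : char_mod -> char_mod -> char_mod).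
Proof. by move=> f g; apply: char_ext => x; apply: addrC. Qed.
Lemma char_add0 : left_id char_zero (char_add : char_mod -> char_mod -> char_mod).
Proof. by move=> f; apply: char_ext => x; apply: add0r. Qed.
Lemma char_addN :
  left_inverse char_zero char_opp (char_add : char_mod -> char_mod -> char_mod).
Proof. by move=> f; apply: char_ext => x; apply: addNr. Qed.

HB.instance Definition _ := GRing.isZmodule.Build char_mod
  char_addA char_addC char_add0 char_addN.

Lemma char_scaleA a b (f : char_mod) :
  char_scale a (char_scale b f) = char_scale (a * b) f.
Proof. by apply: char_ext => x /=; rewrite antiM scalerA. Qed.
Lemma char_scale1 : left_id 1 (char_scale : S -> char_mod -> char_mod).
Proof. by move=> f; apply: char_ext => x /=; rewrite anti1 scale1r. Qed.
Lemma char_scaleDr :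
  right_distributive (char_scale : S -> char_mod -> char_mod) +%R.
Proof. by move=> a f g; apply: char_ext. Qed.
Lemma char_scaleDl (f : char_mod) :
  {morph (fun a => char_scale a f) : a b / a + b}.
Proof.
by move=> a b; apply: char_ext => x /=; rewrite antiD scalerDl raddfD.
Qed.

HB.instance Definition _ := GRing.Zmodule_isLmodule.Build S char_mod
  char_scaleA char_scale1 char_scaleDr char_scaleDl.

Definition char_fun (f : char_mod) : {additive M -> QZ} := f.

End CharacterModule.

Section CharacterMap.
Variables (R S : pzRingType) (t : anti_iso R S) (M N : lmodType R).
Variable f : {linear M -> N}.

Definition char_map (g : character t N) : character t M :=
  char_fun g \o f : {additive M -> QZ}.

Lemma char_map_linear : linear char_map.
Proof.
move=> a g h; apply: char_ext => x.
rewrite -[RHS]/(char_fun g (f (anti t a *: x)) + char_fun h (f x)).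
by rewrite linearZ.
Qed.

HB.instance Definition _ :=
  GRing.isLinear.Build S (character t N) (character t M) *:%R char_map
    char_map_linear.

Lemma char_mapE (g : character t N) x : char_fun (char_map g) x = char_fun g (f x).
Proof. by []. Qed.

Lemma char_map_injective : surjective f -> injective char_map.
Proof.
move=> f_surj; apply: kernel_injective => g gf; apply: char_ext => y.
by have [x <-] := f_surj y; rewrite -[LHS]char_mapE gf.
Qed.

Lemma char_map_surjective : injective f -> surjective char_map.
Proof.
move=> f_inj g; have [h hf] := QZ_injective (char_fun g) f_inj.
by exists h; apply: char_ext.
Qed.

End CharacterMap.

Section CharacterExact.
Variables (R S : pzRingType) (t : anti_iso R S).

Lemma char_exact (A B C : lmodType R) (f : {linear A -> B}) (g : {linear B -> C}) :
  exact f g ->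
  exact (char_map g : {linear character t C -> character t B})
        (char_map f : {linear character t B -> character t A}).
Proof.
move=> fg u; split=> [uf|[v <-]].
  have [I [q [i [q_surj i_inj iq]]]] := image_factorization g.
  have [s qs] := choice q_surj.
  have ker_u x y : q x = q y -> char_fun u x = char_fun u y.
    move=> qxy; apply/eqP; rewrite -subr_eq0 -raddfB.
    have /fg [a <-] : g (x - y) = 0 by rewrite -iq linearB qxy subrr linear0.
    by rewrite -[X in X == 0](char_mapE f) uf.
  have v_add : zmod_morphism (fun y => char_fun u (s y)).
    move=> x y; rewrite -raddfB; apply: ker_u.
    by rewrite linearB !qs.
  have [w wi] := QZ_injective (add v_add) i_inj.
  exists w; apply: char_ext => x; rewrite -[LHS]/(w (g x)) -iq wi /=.
  by apply: ker_u; rewrite qs.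
apply: char_ext => x; rewrite -[LHS]/(char_fun v (g (f x))).
by have /fg -> : exists y, f y = f x; [exists x | rewrite raddf0].
Qed.

Lemma char_short_exact (A B C : lmodType R) (i : {linear A -> B})
    (p : {linear B -> C}) :
  short_exact i p ->
  short_exact (char_map p : {linear character t C -> character t B})
              (char_map i : {linear character t B -> character t A}).
Proof.
move=> [i_inj p_surj ip]; split; first exact: char_map_injective.
  exact: char_map_surjective.
exact: char_exact.
Qed.

Lemma char_retract (M N : lmodType R) :
  retract M N -> retract (character t M) (character t N).
Proof.
move=> [s [p ps]]; exists (char_map p), (char_map s) => f.
by apply: char_ext => x /=; rewrite ps.
Qed.

End CharacterExact.

Section AntiInverse.
Variables (R S : pzRingType) (t : anti_iso R S).

Lemma anti_inv1 : anti_inv t 1 = 1.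
Proof. by rewrite -(anti1 t) antiK. Qed.
Lemma anti_invM a b : anti_inv t (a * b) = anti_inv t b * anti_inv t a.
Proof. by apply: (can_inj (antiK t)); rewrite antiM !anti_invK. Qed.
Lemma anti_invD : {morph anti_inv t : a b / a + b}.
Proof. by move=> a b; apply: (can_inj (antiK t)); rewrite antiD !anti_invK. Qed.

Definition anti_sym : anti_iso S R :=
  AntiIso (anti_invK t) (antiK t) anti_inv1 anti_invM anti_invD.

End AntiInverse.

Definition anti_converse (R : pzRingType) : anti_iso R R^c :=
  @AntiIso R R^c id id (fun=> erefl) (fun=> erefl) erefl
    (fun _ _ => erefl) (fun _ _ => erefl).

Section CharacterDuality.
Variables (R S : pzRingType) (t : anti_iso R S).

(** [Hom_S(A, P^+)] is [Hom_R(P, A^+)], and [A^+] sends injections to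
    surjections, along which maps out of a projective module lift. *)
Lemma char_projective_injective (P : lmodType R) :
  projective P -> injective_module (character t P).
Proof.
move=> P_proj A B g f g_inj; pose t' := anti_sym t.
have f'_add x : zmod_morphism (fun a => char_fun (f a) x).
  by move=> a b; rewrite linearB.
pose f' x : character t' A := add (f'_add x).
have f'_lin : linear f'.
  move=> r x y; apply: char_ext => a.
  rewrite -[RHS]/(char_fun (f (anti_inv t r *: a)) x + char_fun (f a) y).
  rewrite -[LHS]/(char_fun (f a) (r *: x + y)) raddfD; congr (_ + _).
  by rewrite linearZ -[in LHS](anti_invK t r).
have [h' h'P] := P_proj _ _ _ (lin f'_lin) (char_map_surjective (t := t') g_inj).
have h_add b : zmod_morphism (fun x => char_fun (h' x) b).
  by move=> x y; rewrite linearB.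
pose h b : character t P := add (h_add b).
have h_lin : linear h.
  move=> s b c; apply: char_ext => x.
  rewrite -[RHS]/(char_fun (h' (anti t s *: x)) b + char_fun (h' x) c).
  rewrite -[LHS]/(char_fun (h' x) (s *: b + c)) raddfD; congr (_ + _).
  by rewrite linearZ -[in LHS](antiK t s).
exists (lin h_lin) => a; apply: char_ext => x.
by rewrite -[LHS]/(char_fun (char_map g (h' x)) a) h'P.
Qed.

End CharacterDuality.

(** [M] embeds into [M^++], and a projective cover of [M^+] by [F] embeds
    [M^++] into the injective module [F^+]. *)
Lemma enough_injectives (R : pzRingType) (M : lmodType R) :
  exists (E : lmodType R) (i : {linear M -> E}), injective_module E /\ injective i.
Proof.
pose t := anti_converse R; pose t' := anti_sym t.
have [F [p [F_proj p_surj]]] := enough_projectives (character t M).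
have ev_add x : zmod_morphism (fun f : character t M => char_fun f x) by [].
pose ev x : character t' (character t M) := add (ev_add x).
have ev_lin : linear ev.
  move=> r x y; apply: char_ext => f.
  by rewrite -[LHS]/(char_fun f (r *: x + y)) raddfD.
exists (character t' F), (char_map p \o lin ev_lin : {linear _ -> _}); split.
  exact: char_projective_injective.
apply: inj_comp; first exact: char_map_injective.
apply: kernel_injective => x evx; apply: QZ_separates => f.
by have := congr1 (fun g : character t' (character t M) => char_fun g f) evx.
Qed.

(** * Flatness *)

Section Flatness.
Variable R : pzRingType.
Implicit Type M : lmodType R.

Lemma tensor_exists (X : lmodType R^c) M :
  exists (T : zmodType) (t : X -> M -> T), is_tensor t.
Proof.
have [F [e eP]] := free_module int (X * M).
pose K (z : F) := forall (Z : zmodType) (b : X -> M -> Z), balanced b ->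
  forall h : {linear F -> zmodule Z}, (forall c, h (e c) = b c.1 c.2) -> h z = 0.
have K_sub : submodule K.
  split=> [|a x y Kx Ky] Z b b_bal h hP; first exact: linear0.
  by rewrite linearP (Kx _ _ b_bal) // (Ky _ _ b_bal) // scaler0 addr0.
have [T [q [q_surj kerq]]] := quotient_module K_sub.
pose t (x : X) (m : M) : T := q (e (x, m)).
have q_eq z w : K (z - w) -> q z = q w.
  by move=> /kerq; rewrite linearB => /eqP; rewrite subr_eq0 => /eqP.
exists T, t; split=> [|Z b b_bal]; first split=> [x y m|x m n|x r m].
- rewrite /t -linearD; apply: q_eq => Z b b_bal h hP; case: (b_bal) => bD _ _.
  by rewrite linearB linearD !hP /= bD; apply: subrr.
- rewrite /t -linearD; apply: q_eq => Z b b_bal h hP; case: (b_bal) => _ bD _.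
  by rewrite linearB linearD !hP /= bD; apply: subrr.
- rewrite /t; apply: q_eq => Z b b_bal h hP; case: (b_bal) => _ _ bZ.
  by rewrite linearB !hP /= bZ; apply: subrr.
have [[h hP] h_uniq] := eP (zmodule Z) (fun c => b c.1 c.2).
split.
  have [|u uq] := @factor_through_surjection _ _ _ _ q h q_surj.
    by move=> z /kerq /(_ _ _ b_bal); apply.
  by exists (u : {additive _ -> _}) => x m; rewrite -[LHS]/(u (q _)) uq hP.
move=> u v uv y; have [z <-] := q_surj y.
have lin_int (w : {additive T -> Z}) : linear (fun z : F => w (q z) : zmodule Z).
  move=> a x x'; rewrite linearP raddfD; congr (_ + _).
  by rewrite -[in LHS](intz a) scaler_int raddfMz.
have [_ e_uniq] := eP (zmodule Z) (fun=> 0).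
apply: (e_uniq (lin (lin_int u)) (lin (lin_int v))) => -[x m] /=.
exact: uv.
Qed.

Let t := anti_converse R.

(** The characters of [X (x) M] are the linear maps from [X] to [M^+], and
    characters both extend along injections and detect zero. *)
Theorem flat_char M : flat M <-> injective_module (character t M).
Proof.
split=> [M_flat A B g f g_inj | M_inj X Y f f_inj T U tX tY tX_tens tY_tens].
  have [T [tA tA_tens]] := tensor_exists A M.
  have [U [tB tB_tens]] := tensor_exists B M.
  have [tA_bal tA_univ] := tA_tens; have [tB_bal tB_univ] := tB_tens.
  have [|[u uP] _] := tA_univ QZ (fun a m => char_fun (f a) m).
    split=> [x y m|x m n|x r m]; first by rewrite linearD.
      by rewrite raddfD.
    by rewrite linearZ.
  have [|[gM gMP] _] := tA_univ U (fun a m => tB (g a) m).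
    case: tB_bal => b1 b2 b3.
    by split=> [x y m|x m n|x r m]; rewrite ?linearD ?linearZ ?b1 ?b2 ?b3.
  have gM_inj := M_flat _ _ g g_inj _ _ _ _ tA_tens tB_tens gM gMP.
  have [v vP] := QZ_injective u gM_inj.
  case: tB_bal => b1 b2 b3.
  have h_add b : zmod_morphism (fun m => v (tB b m)).
    move=> m n; apply/eqP; rewrite eq_sym subr_eq -raddfD -b2.
    by rewrite subrK.
  pose h b : character t M := add (h_add b).
  have h_lin : linear h.
    move=> r b c; apply: char_ext => m.
    rewrite -[LHS]/(v (tB (r *: b + c) m)) b1 raddfD b3.
    by [].
  exists (lin h_lin) => a; apply: char_ext => m.
  by rewrite -[LHS]/(v (tB (g a) m)) -gMP vP uP.
move=> fM fMP x y fMxy; apply/eqP; rewrite -subr_eq0; apply/eqP.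
apply: QZ_separates => chi.
have [[b1 b2 b3] tX_univ] := tX_tens; have [[c1 c2 c3] tY_univ] := tY_tens.
have g_add a : zmod_morphism (fun m => chi (tX a m)).
  move=> m n; apply/eqP; rewrite eq_sym subr_eq -raddfD -b2.
  by rewrite subrK.
pose g a : character t M := add (g_add a).
have g_lin : linear g.
  move=> r b c; apply: char_ext => m.
  by rewrite -[LHS]/(chi (tX (r *: b + c) m)) b1 raddfD b3.
have [h hP] := M_inj _ _ f (lin g_lin) f_inj.
have [|[v vP] _] := tY_univ QZ (fun b m => char_fun (h b) m).
  split=> [? ? ?|? ? ?|? ? ?]; first by rewrite linearD.
    by rewrite raddfD.
  by rewrite linearZ.
have [|_ uniq] := tX_univ QZ (fun a m => chi (tX a m)).
  by split=> [? ? ?|? ? ?|? ? ?]; rewrite ?b1 ?b2 ?b3 ?raddfD.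
rewrite -(uniq (v \o fM : {additive _ -> _}) chi) => [|a m] /=.
  by rewrite raddfB fMxy subrr raddf0.
by rewrite fMP vP hP.
Qed.

End Flatness.


(** * Injective dimension *)

Section InjectiveDimension.
Variable R : pzRingType.
Implicit Types A B C M N E : lmodType R.

Definition pair_map A B C (f : A -> B) (g : A -> C) (x : A) : B * C := (f x, g x).

Lemma pair_map_linear A B C (f : {linear A -> B}) (g : {linear A -> C}) :
  linear (pair_map f g).
Proof. by move=> a x y; rewrite /pair_map !linearP. Qed.

HB.instance Definition _ A B C (f : {linear A -> B}) (g : {linear A -> C}) :=
  GRing.isLinear.Build R A (B * C)%type *:%R (pair_map f g)
    (pair_map_linear f g).

Lemma retract_refl M : retract M M.
Proof. by exists idfun, idfun. Qed.

Lemma bijection_retract A B (f : {linear A -> B}) :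
  injective f -> surjective f -> retract B A.
Proof.
move=> f_inj f_surj; have [|g gf] := @factor_through_surjection _ _ _ _ f idfun f_surj.
  by move=> x; apply: injective_kernel.
by exists g, f => y; have [x <-] := f_surj y; rewrite gf.
Qed.

Lemma isomorphic_retract M N : isomorphic M N -> retract M N.
Proof.
move=> [f f_bij]; have f_inj := bij_inj f_bij.
have [|g fg] := @factor_through_injection _ _ _ _ f idfun f_inj.
  by case: f_bij => g _ fK x; exists (g x); rewrite fK.
by exists f, g => x; apply: f_inj; rewrite fg.
Qed.

Lemma injective_retract M N :
  retract M N -> injective_module N -> injective_module M.
Proof.
move=> [s [p ps]] N_inj A B g f g_inj.
have [h hg] := N_inj _ _ g (s \o f : {linear A -> N}) g_inj.
by exists (p \o h : {linear _ -> _}) => x /=; rewrite hg /= ps.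
Qed.

Lemma injective_sum M N :
  injective_module M -> injective_module N -> injective_module (M * N)%type.
Proof.
move=> M_inj N_inj A B g f g_inj.
have [h hg] := M_inj _ _ g (fst \o f : {linear A -> M}) g_inj.
have [k kg] := N_inj _ _ g (snd \o f : {linear A -> N}) g_inj.
exists (pair_map h k : {linear _ -> _}) => x.
by rewrite /= /pair_map hg kg /=; case: (f x).
Qed.

Lemma zero_injective M : zero_module M -> injective_module M.
Proof. by move=> M0 A B g f _; exists \0 => x; rewrite [RHS]M0. Qed.

Fixpoint id_le (m : nat) N : Prop :=
  if m is m'.+1 then
    exists E C (i : {linear N -> E}) (q : {linear E -> C}),
      [/\ short_exact i q, injective_module E & id_le m' C]
  else injective_module N.

Lemma injective_id_le m E : injective_module E -> id_le m E.
Proof.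
elim: m E => // m IHm E E_inj; have [C [q [q_surj q_ex]]] := cokernel (@idfun E).
exists E, C, idfun, q; split=> //; first by split=> // x y.
apply: IHm; apply: zero_injective => c.
by have [x <-] := q_surj c; apply/q_ex; exists x.
Qed.

Lemma short_exact_sum A B C A' B' C' (i : {linear A -> B}) (q : {linear B -> C})
    (i' : {linear A' -> B'}) (q' : {linear B' -> C'}) :
  short_exact i q -> short_exact i' q' ->
  short_exact (pair_map (i \o fst) (i' \o snd) :
                 {linear (A * A')%type -> (B * B')%type})
              (pair_map (q \o fst) (q' \o snd) :
                 {linear (B * B')%type -> (C * C')%type}).
Proof.
move=> [i_inj q_surj iq] [i'_inj q'_surj iq']; split.
- by move=> [x x'] [y y'] [/i_inj -> /i'_inj ->].
- move=> [c c']; have [b <-] := q_surj c; have [b' <-] := q'_surj c'.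
  by exists (b, b').
- move=> [b b']; split=> [[/iq [a <-] /iq' [a' <-]]|[[a a'] [<- <-]]].
    by exists (a, a').
  have /iq q0 : exists x, i x = i a by exists a.
  have /iq' q0' : exists x, i' x = i' a' by exists a'.
  by rewrite /= /pair_map /= q0 q0'.
Qed.

Lemma id_le_sum m M N : id_le m M -> id_le m N -> id_le m (M * N)%type.
Proof.
elim: m M N => [|m IHm] M N; first exact: injective_sum.
move=> [E [C [i [q [iq E_inj C_le]]]]] [E' [C' [i' [q' [iq' E'_inj C'_le]]]]].
exists (E * E')%type, (C * C')%type, (pair_map (i \o fst) (i' \o snd)),
  (pair_map (q \o fst) (q' \o snd)).
split; [exact: short_exact_sum|exact: injective_sum|exact: IHm].
Qed.

(** A form of Schanuel's lemma.  The maps [M -> N -> M] extend to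
    [E' -> E -> E']; the composite differs from the identity by a map that
    vanishes on [M], hence by a map [C' -> E'], which corrects the retraction. *)
Lemma cosyzygy_retract M E' C' N E C
    (i : {linear M -> E'}) (q : {linear E' -> C'})
    (j : {linear N -> E}) (r : {linear E -> C}) :
  short_exact i q -> short_exact j r -> injective_module E' ->
  injective_module E -> retract M N -> retract C' (C * E')%type.
Proof.
move=> [i_inj q_surj iq] [j_inj r_surj jr] E'_inj E_inj [s [p ps]].
have [s' s'P] := E_inj _ _ i (j \o s : {linear _ -> _}) i_inj.
have [p' p'P] := E'_inj _ _ j (i \o p : {linear _ -> _}) j_inj.
have [|h hq] := @factor_through_surjection _ _ _ _ q
    ((p' \o s') \- idfun : {linear E' -> E'}) q_surj.
  by move=> x /iq [m <-] /=; rewrite s'P /= p'P /= ps subrr.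
have [|sb sbq] := @factor_through_surjection _ _ _ _ q
    (r \o s' : {linear E' -> C}) q_surj.
  by move=> x /iq [m <-] /=; rewrite s'P; apply/jr; exists (s m).
have [|pb pbr] := @factor_through_surjection _ _ _ _ r
    (q \o p' : {linear E -> C'}) r_surj.
  by move=> x /jr [m <-] /=; rewrite p'P; apply/iq; exists (p m).
exists (pair_map sb h), ((pb \o fst) \- (q \o snd) : {linear _ -> _}) => c.
have [x <-] := q_surj c; rewrite /= sbq hq /= pbr /= linearB.
by rewrite opprB addrC subrK.
Qed.

Lemma id_le_retract m M N : retract M N -> id_le m N -> id_le m M.
Proof.
elim: m M N => [|m IHm] M N MN; first exact: injective_retract.
move=> [E [C [j [r [jr E_inj C_le]]]]]; have [s [p ps]] := MN.
have [C' [q [q_surj q_ex]]] := cokernel (j \o s : {linear M -> E}).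
have iq : short_exact (j \o s : {linear M -> E}) q.
  split=> //; case: jr => j_inj _ _; apply: inj_comp => //.
  exact: can_inj ps.
exists E, C', (j \o s), q; split=> //.
apply: IHm (cosyzygy_retract iq jr E_inj E_inj MN) _.
by apply: id_le_sum => //; apply: injective_id_le.
Qed.

Lemma id_le_cosyzygy m N E C (j : {linear N -> E}) (r : {linear E -> C}) :
  short_exact j r -> injective_module E -> id_le m.+1 N -> id_le m C.
Proof.
move=> jr E_inj [E' [C' [i [q [iq E'_inj C'_le]]]]].
apply: id_le_retract (cosyzygy_retract jr iq E_inj E'_inj (retract_refl N)) _.
by apply: id_le_sum => //; apply: injective_id_le.
Qed.

End InjectiveDimension.

(** * Left resolutions *)

Section LeftResolutions.
Variable R : pzRingType.
Implicit Types M K F : lmodType R.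

Lemma lres_aug_surj M (X : left_resolution M) : surjective (lres_aug X).
Proof. by case: X. Qed.

Lemma lres_exact0 M (X : left_resolution M) : exact (lres_d X 0) (lres_aug X).
Proof. by case: X. Qed.

Lemma lres_exact M (X : left_resolution M) j :
  exact (lres_d X j.+1) (lres_d X j).
Proof. by case: X => /= *. Qed.

Section Cons.
Variables (M K F : lmodType R) (i : {linear K -> F}) (p : {linear F -> M}).
Hypothesis ip : short_exact i p.
Variable X : left_resolution K.

Definition cons_obj j : lmodType R := if j is j'.+1 then X j' else F.

Definition cons_d j : {linear cons_obj j.+1 -> cons_obj j} :=
  match j return {linear cons_obj j.+1 -> cons_obj j} with
  | 0 => i \o lres_aug X
  | j'.+1 => lres_d X j'
  end.

Lemma cons_surjective : surjective p. Proof. by case: ip. Qed.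

Lemma cons_exact0 : exact (cons_d 0) p.
Proof.
case: ip => _ _ ip_ex y; split=> [/ip_ex [k <-]|[x <-]].
  by have [x <-] := @lres_aug_surj _ X k; exists x.
by apply/ip_ex; exists (lres_aug X x).
Qed.

Lemma cons_exact j : exact (cons_d j.+1) (cons_d j).
Proof.
case: ip => i_inj _ _; case: j => [|j] /=; last exact: lres_exact.
move=> y /=; rewrite -lres_exact0.
by split=> [|->]; [apply: injective_kernel | apply: linear0].
Qed.

Definition cons_resolution : left_resolution M :=
  @LeftResolution R M cons_obj cons_d p cons_surjective cons_exact0 cons_exact.

End Cons.

Section Tail.
Variables (M : lmodType R) (X : left_resolution M) (K : lmodType R).
Variables (r : {linear X 1%N -> K}) (i : {linear K -> X 0%N}).
Hypotheses (r_surj : surjective r) (i_inj : injective i).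
Hypothesis ir : forall x, i (r x) = lres_d X 0 x.

Lemma tail_short_exact : short_exact i (lres_aug X).
Proof.
split=> //; first exact: lres_aug_surj.
move=> y; rewrite lres_exact0; split=> [[x <-]|[k <-]]; first by exists (r x).
by have [x <-] := r_surj k; exists x.
Qed.

Lemma tail_exact0 : exact (lres_d X 1) r.
Proof.
move=> y; rewrite -(@lres_exact _ X 0) -ir; split=> [->|]; first exact: linear0.
exact: injective_kernel.
Qed.

Lemma tail_exact j : exact (lres_d X j.+2) (lres_d X j.+1).
Proof. exact: lres_exact. Qed.

Definition tail_resolution : left_resolution K :=
  @LeftResolution R K (fun j => X j.+1) (fun j => lres_d X j.+1) r
    r_surj tail_exact0 tail_exact.

End Tail.

Definition null_module : lmodType R := 'rV[R]_0.

Lemma null_moduleP : zero_module null_module.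
Proof. by move=> x; apply/rowP => -[]. Qed.

Lemma null_exact (A B C : lmodType R) (f : {linear A -> B}) (g : {linear B -> C}) :
  zero_module B -> exact f g.
Proof.
by move=> B0 y; rewrite (B0 y); split=> _; [exists 0|]; rewrite linear0.
Qed.

Lemma null_surjective : surjective (@idfun null_module).
Proof. by move=> x; exists x. Qed.

Definition null_resolution : left_resolution null_module :=
  @LeftResolution R null_module (fun=> null_module)
    (fun=> \0) idfun null_surjective
    (null_exact _ _ null_moduleP) (fun=> null_exact _ _ null_moduleP).

Lemma null_short_exact M :
  short_exact (\0 : {linear null_module -> M}) (@idfun M).
Proof.
split=> [x y _|x|y]; first by rewrite [x]null_moduleP [y]null_moduleP.
  by exists x.
by split=> /= [->|[x <-]] //; exists 0.
Qed.

Definition resolution_in_degree_zero M : left_resolution M :=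
  cons_resolution (null_short_exact M) null_resolution.

End LeftResolutions.

(** * Flat dimension *)

Section FlatDimension.
Variable R : pzRingType.
Implicit Types M N : lmodType R.
Let t := anti_converse R.

Lemma zero_flat M : zero_module M -> flat M.
Proof.
move=> M0; apply/flat_char/zero_injective => f; apply: char_ext => x.
by rewrite (M0 x) !raddf0.
Qed.

Lemma projective_flat M : projective M -> flat M.
Proof. by move=> M_proj; apply/flat_char/char_projective_injective. Qed.

Lemma fd_le_cons (M K F : lmodType R) (i : {linear K -> F}) (p : {linear F -> M}) m :
  short_exact i p -> flat F -> fd_le K m -> fd_le M m.+1.
Proof.
move=> ip F_flat [X [X_flat X0]]; exists (cons_resolution ip X).
by split=> [[|j]|[|j]] //=; apply: X0.
Qed.

(** Characters turn flat resolutions of [M] into injective coresolutions of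
    [M^+].  Conversely the syzygies of any projective resolution of [M] dualize to
    cosyzygies of [M^+], the injectivity of which is decided by Schanuel's lemma. *)
Theorem fd_le_char M m : fd_le M m <-> id_le m (character t M).
Proof.
split; elim: m M => [|m IHm] M.
- move=> [X [X_flat X0]]; have := (flat_char _).1 (X_flat 0%N).
  apply: injective_retract; apply: char_retract.
  apply: (bijection_retract (f := lres_aug X)).
    apply: kernel_injective => x /lres_exact0 [y <-].
    by rewrite (X0 1%N isT y) linear0.
  exact: lres_aug_surj.
- move=> [X [X_flat X0]].
  have [K [r [i [r_surj i_inj ir]]]] := image_factorization (lres_d X 0).
  have K_le : fd_le K m.
    exists (tail_resolution r_surj i_inj ir).
    by split=> j; [apply: X_flat | move=> mj; apply: X0].
  have iX := char_short_exact t (tail_short_exact r_surj i_inj ir).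
  exists (character t (X 0%N)), (character t K); do 2!eexists.
  by split; [exact: iX | exact/flat_char | exact: IHm].
- move=> /flat_char M_flat; exists (resolution_in_degree_zero M).
  by split=> [[|j]|[|j]] //= *; [apply: zero_flat|]; apply: null_moduleP.
- move=> M_le; have [P [p [P_proj p_surj]]] := enough_projectives M.
  have [K [i [i_inj ip]]] := kernel p.
  have ip_ex : short_exact i p by [].
  apply: (fd_le_cons ip_ex (projective_flat P_proj)); apply: IHm.
  apply: id_le_cosyzygy M_le; first exact: (char_short_exact t ip_ex).
  exact: char_projective_injective.
Qed.

Lemma fd_le_retract m M N : retract M N -> fd_le N m -> fd_le M m.
Proof.
move=> MN /fd_le_char N_le; apply/fd_le_char; apply: id_le_retract N_le.
exact: char_retract.
Qed.

Lemma fd_le_sum m M N : fd_le M m -> fd_le N m -> fd_le (M * N)%type m.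
Proof.
move=> /fd_le_char M_le /fd_le_char N_le; apply/fd_le_char.
apply: id_le_retract (id_le_sum M_le N_le).
exists (pair_map (char_map (pair_map idfun \0 : {linear M -> (M * N)%type}))
                 (char_map (pair_map \0 idfun : {linear N -> (M * N)%type}))).
exists ((char_map (fst : {linear (M * N)%type -> M}) \o fst) \+
        (char_map (snd : {linear (M * N)%type -> N}) \o snd)
        : {linear _ -> _}) => f.
apply: char_ext => -[x y].
rewrite -[LHS]/(char_fun f (x, 0) + char_fun f (0, y)) -raddfD.
by congr (char_fun f (_, _)); rewrite ?addr0 ?add0r.
Qed.

Lemma fd_le_mono m m' M : (m <= m')%N -> fd_le M m -> fd_le M m'.
Proof.
move=> mm' [X [X_flat X0]]; exists X; split=> // j m'j.
by apply: X0; apply: leq_ltn_trans m'j.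
Qed.

End FlatDimension.


(** * Minimal injective resolutions *)

Section Envelopes.
Variable R : pzRingType.
Implicit Types A B C M N E : lmodType R.

Lemma essentialP A B (f : {linear A -> B}) :
  essential f <-> forall S : B -> Prop, submodule S ->
    (forall x, S (f x) -> f x = 0) -> forall y, S y -> y = 0.
Proof.
split=> f_ess S S_sub Sf y Sy.
  apply: (f_ess [pred x | `[< S x >]]); last exact/asboolP.
    split=> [|a u v /asboolP Su /asboolP Sv]; apply/asboolP.
      exact: submodule0.
    exact: S_sub.2.
  by move=> x /asboolP; apply: Sf.
by apply: (f_ess (fun x => x \in S)).
Qed.

Lemma essential_injective A B C (f : {linear A -> B}) (g : {linear B -> C}) :
  essential f -> (forall x, g (f x) = 0 -> f x = 0) -> injective g.
Proof.
move=> /essentialP f_ess gf; apply: kernel_injective.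
exact: f_ess (kernel_submodule g) gf.
Qed.

(** Inside an injective module [E0] containing [M], let [S] be maximal with
    [S] and [M] disjoint, and [T] maximal containing [M] with [S] and [T]
    disjoint.  Then [M] is essential in [E0 / S], the inclusion of [T] in [E0]
    extends to an injection [h] of [E0 / S] into [E0], the image of which is
    still disjoint from [S] and hence is [T]; so [E0 / S] is a retract of [E0]. *)
Lemma injective_envelope M : exists E (i : {linear M -> E}),
  [/\ injective_module E, injective i & essential i].
Proof.
have [E0 [j [E0_inj j_inj]]] := enough_injectives M.
pose imM x := exists m, j m = x.
have [||S [S_sub _ MS S_max]] := @maximal_disjoint R E0 imM (fun x => x = 0).
- by split=> // a x y -> ->; rewrite scaler0 addr0.
- by [].
have [||T [T_sub MT ST T_max]] := @maximal_disjoint R E0 S imM.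
- exact: image_submodule.
- by move=> x Sx Mx; apply: MS.
have [Q [q [q_surj kerq]]] := quotient_module S_sub.
have [K [k [k_inj Tk]]] := submodule_carrier T_sub.
have qk_inj : injective (q \o k).
  apply: kernel_injective => x /= /kerq Sx; apply: injective_kernel k_inj _.
  by apply: ST Sx _; apply/Tk; exists x.
have [h hP] := E0_inj _ _ (q \o k : {linear _ -> _}) k qk_inj.
have hT x : T x -> h (q x) = x by move=> /Tk [z <-]; apply: hP.
(* The maximality of S, read on T instead of M. *)
have trace (S' : E0 -> Prop) : submodule S' -> (forall x, S x -> S' x) ->
    (forall x, T x -> S' x -> x = 0) -> forall x, S' x -> S x.
  by move=> S'_sub SS' TS'; apply: S_max => // x /MT; apply: TS'.
have h_inj : injective h.
  apply: kernel_injective => y; have [x <-] := q_surj y => hx; apply/kerq.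
  apply: (trace (fun x => h (q x) = 0)) => //.
  - exact: (kernel_submodule (h \o q : {linear _ -> _})).
  - by move=> z /kerq ->; rewrite linear0.
  - by move=> z /hT ->.
have imhT x : (exists y, h y = x) -> T x.
  apply: (T_max (fun x => exists y, h y = x)); first exact: image_submodule.
    by move=> y /hT <-; exists (q y).
  move=> y Sy [z zy]; rewrite -{y}zy in Sy *.
  have [e ez] := q_surj z; rewrite -{z}ez in Sy *.
  suff /kerq -> : S e by rewrite linear0.
  apply: (trace (fun x => S (h (q x)))) => //.
  - split=> [|a u v Su Sv]; first by rewrite !linear0; apply: submodule0.
    by rewrite !linearP; apply: S_sub.2.
  - by move=> z /kerq ->; rewrite linear0; apply: submodule0.
  - by move=> z Tz; rewrite hT // => Sz; apply: ST.
exists Q, (q \o j : {linear _ -> _}); split.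
- apply: injective_retract E0_inj; exists h, q => y.
  by apply: h_inj; rewrite hT //; apply: imhT; exists y.
- apply: kernel_injective => x /= /kerq Sx; apply: injective_kernel j_inj _.
  by apply: MS Sx; exists x.
- apply/essentialP => S' S'_sub S'f y; have [x <-] := q_surj y => S'x.
  apply/kerq; apply: (S_max (fun x => S' (q x))) => //.
  + split=> [|a u v Su Sv]; first by rewrite linear0; apply: submodule0.
    by rewrite linearP; apply: S'_sub.2.
  + by move=> z /kerq ->; apply: submodule0.
  + by move=> z [m <-] /S'f /kerq Sm; apply: MS => //; exists m.
Qed.

(** Bundled so that a choice of one for every module can be iterated. *)
Record min_cosyzygy M := MinCosyzygy {
  envelope : lmodType R;
  cosyzygy : lmodType R;
  envelope_map : {linear M -> envelope};
  cosyzygy_map : {linear envelope -> cosyzygy};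
  cosyzygy_exact : short_exact envelope_map cosyzygy_map;
  envelope_injective : injective_module envelope;
  envelope_essential : essential envelope_map
}.

Lemma min_cosyzygy_exists M : inhabited (min_cosyzygy M).
Proof.
have [E [i [E_inj i_inj i_ess]]] := injective_envelope M.
by have [C [q [q_surj iq]]] := cokernel i; do 2!esplit; eauto; split.
Qed.

Lemma min_injective_resolution_exists M : inhabited (min_injective_resolution M).
Proof.
have [step] : inhabited (forall N, min_cosyzygy N).
  by split=> N; apply: inhabited_witness (min_cosyzygy_exists N).
pose fix Z i := if i is j.+1 then cosyzygy (step (Z j)) else M.
pose I i := envelope (step (Z i)).
pose d i : {linear I i -> I i.+1} :=
  envelope_map (step (Z i.+1)) \o cosyzygy_map (step (Z i)).
have ker_d i x : d i x = 0 <-> exists z, envelope_map (step (Z i)) z = x.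
  have [_ _ <-] := cosyzygy_exact (step (Z i)).
  have [e_inj _ _] := cosyzygy_exact (step (Z i.+1)).
  by split=> [/(injective_kernel e_inj)|/= ->] //; rewrite linear0.
have im_d i y : (exists x, d i x = y) <->
    exists z, envelope_map (step (Z i.+1)) z = y.
  have [_ q_surj _] := cosyzygy_exact (step (Z i)).
  split=> [[x <-]|[z <-]]; first by eexists.
  by have [x <-] := q_surj z; exists x.
split; apply: (@MinInjectiveResolution R M I (envelope_map (step M)) d).
- by case: (cosyzygy_exact (step M)).
- exact: (ker_d 0%N).
- by move=> i y; rewrite im_d; apply: ker_d.
- by move=> i; apply: envelope_injective.
- exact: envelope_essential.
- move=> i; apply/essentialP => S S_sub Sd.
  apply: ((essentialP _).1 (@envelope_essential _ (step (Z i.+1))) _ S_sub) => z.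
  have /im_d [x <-] : exists z', envelope_map (step (Z i.+1)) z' =
    envelope_map (step (Z i.+1)) z by exists z.
  exact: Sd.
Qed.

Section TailOfMinimal.
Variables (M : lmodType R) (I : min_injective_resolution M).
Variables (C : lmodType R) (q : {linear I 0%N -> C}) (i : {linear C -> I 1%N}).
Hypotheses (q_surj : surjective q) (i_inj : injective i).
Hypothesis iq : forall x, i (q x) = ires_d I 0 x.

Lemma ires_aug_injective : injective (ires_aug I).
Proof. by case: I. Qed.

Lemma ires_aug_essential : essential (ires_aug I).
Proof. by case: I. Qed.

Lemma ires_injective j : injective_module (I j).
Proof. by case: I => /= *. Qed.

Lemma ires_exact j : exact (ires_d I j) (ires_d I j.+1).
Proof. by case: I => /= *. Qed.

Lemma ires_essential j : essential (ires_d I j).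
Proof. by case: I => /= *. Qed.

Lemma min_tail_short_exact : short_exact (ires_aug I) q.
Proof.
split=> //; first exact: ires_aug_injective.
have ex0 : exact (ires_aug I) (ires_d I 0) by case: I.
move=> y; rewrite -ex0 -iq; split=> [->|]; first exact: linear0.
exact: injective_kernel.
Qed.

Lemma min_tail_exact0 : exact i (ires_d I 1).
Proof.
move=> y; rewrite (@ires_exact 0); split=> [[x <-]|[c <-]].
  by exists (q x).
by have [x <-] := q_surj c; exists x.
Qed.

Lemma min_tail_essential : essential i.
Proof.
apply/essentialP => S S_sub Si.
have /essentialP d_ess := @ires_essential 0; apply: (d_ess S S_sub) => x.
by rewrite -iq; apply: Si.
Qed.

Definition min_tail : min_injective_resolution C :=
  @MinInjectiveResolution R C (fun j => I j.+1) i (fun j => ires_d I j.+1)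
    i_inj min_tail_exact0 (fun j => @ires_exact j.+1)
    (fun j => @ires_injective j.+1) min_tail_essential
    (fun j => @ires_essential j.+1).

End TailOfMinimal.

(** * Coresolutions with bounded flat dimensions *)

(** The coresolution need not be minimal: this makes the condition stable under
    extensions, while [fd_inj_leP] identifies it with the one on the minimal
    resolution. *)
Fixpoint cores_le (n k : nat) M : Prop :=
  if n is n'.+1 then
    exists E C (i : {linear M -> E}) (q : {linear E -> C}),
      [/\ short_exact i q, injective_module E, fd_le E k & cores_le n' k.+1 C]
  else True.

Lemma cores_le_mono n k M : cores_le n k M -> cores_le n k.+1 M.
Proof.
elim: n k M => // n IHn k M [E [C [i [q [iq E_inj E_le C_le]]]]].
exists E, C, i, q; split=> //; last exact: IHn.
exact: fd_le_mono (leqnSn k) E_le.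
Qed.

Lemma min_cores_le n k M (I : min_injective_resolution M) :
  (forall i, (i < n)%N -> fd_le (I i) (i + k)) -> cores_le n k M.
Proof.
elim: n k M I => // n IHn k M I I_le.
have [C [q [i [q_surj i_inj iq]]]] := image_factorization (ires_d I 0).
exists (I 0%N), C, (ires_aug I), q; split.
- exact: min_tail_short_exact i_inj iq.
- exact: ires_injective.
- exact: (I_le 0%N).
- apply: (IHn _ _ (min_tail q_surj i_inj iq)) => j jn /=.
  by rewrite -addSnnS; apply: I_le.
Qed.

(** A minimal resolution of a retract [M] of [N] is a retract of every injective
    coresolution of [N]: the endomorphism [p' s'] of [I 0] extends the identity
    of [M], so it is injective by essentiality and has a left inverse [u], which
    is also the identity on [M]. *)
Lemma cores_le_min n k M N (I : min_injective_resolution M) :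
  retract M N -> cores_le n k N ->
  forall i, (i < n)%N -> fd_le (I i) (i + k).
Proof.
elim: n k M N I => // n IHn k M N I [s [p ps]].
move=> [E [D [j [r [jr E_inj E_le D_le]]]]].
have [C [q [i [q_surj i_inj iq]]]] := image_factorization (ires_d I 0).
have [a_inj _ aq] := min_tail_short_exact q_surj i_inj iq.
have [j_inj r_surj jr_ex] := jr; have I0_inj := @ires_injective _ I 0%N.
have [s' s'P] := E_inj _ _ (ires_aug I) (j \o s : {linear _ -> _}) a_inj.
have [p' p'P] := I0_inj _ _ j (ires_aug I \o p : {linear _ -> _}) j_inj.
have ps'P m : p' (s' (ires_aug I m)) = ires_aug I m.
  by rewrite s'P /= p'P /= ps.
have ps'_inj : injective (p' \o s').
  apply: essential_injective (@ires_aug_essential _ I) _ => m /=.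
  by rewrite ps'P.
have [u uP] := I0_inj _ _ (p' \o s' : {linear _ -> _}) idfun ps'_inj.
have u_id m : u (ires_aug I m) = ires_aug I m by rewrite -[in LHS]ps'P uP.
have CD : retract C D.
  have [|sb sbq] := @factor_through_surjection _ _ _ _ q
      (r \o s' : {linear I 0%N -> D}) q_surj.
    by move=> x /aq [m <-] /=; rewrite s'P; apply/jr_ex; exists (s m).
  have [|pb pbr] := @factor_through_surjection _ _ _ _ r
      (q \o (u \o p') : {linear E -> C}) r_surj.
    by move=> x /jr_ex [m <-] /=; rewrite p'P /= u_id; apply/aq; exists (p m).
  by exists sb, pb => c; have [x <-] := q_surj c; rewrite sbq /= pbr /= uP.
case=> [_|l ln].
  apply: fd_le_retract E_le.
  by exists s', (u \o p' : {linear _ -> _}) => x; apply: uP.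
by rewrite addSnnS; apply: (IHn k.+1 C D (min_tail q_surj i_inj iq) CD D_le).
Qed.

Lemma cores_le_retract n k M N : retract M N -> cores_le n k N -> cores_le n k M.
Proof.
have [I] := min_injective_resolution_exists M.
by move=> MN N_le; apply: (min_cores_le (I := I)); apply: cores_le_min N_le.
Qed.

(** The horseshoe lemma: the embedding of [A] in [E] extends to [B] and, together
    with the embedding of [C] in [E'], embeds [B] in [E * E'] with a cokernel that
    is an extension of the two cokernels. *)
Lemma cores_le_extension n k A B C (a : {linear A -> B}) (b : {linear B -> C}) :
  short_exact a b -> cores_le n k A -> cores_le n k C -> cores_le n k B.
Proof.
elim: n k A B C a b => // n IHn k A B C a b [a_inj b_surj ab].
move=> [E [D [i [q [[i_inj q_surj iq] E_inj E_le D_le]]]]].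
move=> [E' [D' [i' [q' [[i'_inj q'_surj iq'] E'_inj E'_le D'_le]]]]].
have [u ua] := E_inj _ _ a i a_inj.
pose v : {linear B -> (E * E')%type} := pair_map u (i' \o b).
have vE x : v x = (u x, i' (b x)) by [].
have v_inj : injective v.
  apply: kernel_injective => x; rewrite vE => -[ux /(injective_kernel i'_inj)].
  by move=> /ab [y xy]; move: ux; rewrite -xy ua => /(injective_kernel i_inj) ->;
     rewrite linear0.
have [X [w [w_surj vw]]] := cokernel v.
have [|alpha alphaP] := @factor_through_surjection _ _ _ _ q
    (w \o pair_map idfun \0 : {linear E -> X}) q_surj.
  move=> y /iq [x <-]; apply/vw; exists (a x).
  have /ab bax : exists y, a y = a x by exists x.
  by rewrite vE bax ua linear0.
have [|beta betaP] := @factor_through_surjection _ _ _ _ w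
    (q' \o snd : {linear (E * E')%type -> D'}) w_surj.
  by move=> y /vw [x <-]; apply/iq'; exists (b x).
exists (E * E')%type, X, v, w; split=> //.
- exact: injective_sum.
- exact: fd_le_sum.
apply: (IHn k.+1 D X D' alpha beta) => //; split.
- apply: kernel_injective => z; have [y <-] := q_surj z.
  rewrite alphaP => /vw [x]; rewrite vE => -[xy /(injective_kernel i'_inj)].
  by move=> /ab [t tx]; apply/iq; exists t; rewrite -ua tx.
- move=> z; have [y <-] := q'_surj z; exists (w (0, y)); exact: betaP.
- move=> z; have [[x y] <-] := w_surj z; rewrite betaP /= iq'; split.
    move=> [c cy]; have [t tc] := b_surj c; exists (q (x - u t)).
    rewrite alphaP /=; apply/eqP; rewrite -subr_eq0 -linearB; apply/eqP/vw.
    exists (- t); rewrite vE !linearN tc cy.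
    by congr pair; rewrite /= ?sub0r // addrAC subrr add0r.
  move=> [c]; have [e <-] := q_surj c; rewrite alphaP => wE.
  apply/iq'; rewrite -[y]/((x, y).2) -[q' _]/((q' \o snd) (x, y)) -betaP -wE.
  by rewrite betaP /= linear0.
Qed.

(** Embed [A] into the first term [E] for [P]: the cokernel [E / A] is an extension
    of [E / P] by [P / A = K], so the bounds for [K] are used one step later. *)
Lemma cores_le_syzygy n k (A P K : lmodType R) (a : {linear A -> P}) (b : {linear P -> K}) :
  short_exact a b -> cores_le n.+1 k P -> cores_le n k K ->
  cores_le n.+1 k A.
Proof.
move=> [a_inj b_surj ab] [E [C [j [r [[j_inj r_surj jr] E_inj E_le C_le]]]]].
move=> /cores_le_mono K_le.
have [X [w [w_surj jaw]]] := cokernel (j \o a : {linear A -> E}).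
have [|alpha alphaP] := @factor_through_surjection _ _ _ _ b
    (w \o j : {linear P -> X}) b_surj.
  by move=> x /ab [y <-]; apply/jaw; exists y.
have [|beta betaP] := @factor_through_surjection _ _ _ _ w r w_surj.
  by move=> x /jaw [y <-]; apply/jr; exists (a y).
exists E, X, (j \o a), w; split=> //.
  by split=> //; apply: inj_comp.
apply: (@cores_le_extension _ _ _ _ _ alpha beta) => //; split.
- apply: kernel_injective => y; have [x <-] := b_surj y.
  by rewrite alphaP => /jaw [z /j_inj zx]; apply/ab; exists z.
- by move=> y; have [x <-] := r_surj y; exists (w x); rewrite betaP.
- move=> y; have [x <-] := w_surj y; rewrite betaP jr.
  split=> [[z <-]|[z]]; first by exists (b z); rewrite alphaP.
  have [t <-] := b_surj z; rewrite alphaP /= => /eqP.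
  rewrite -subr_eq0 -linearB => /eqP /jaw [v /= jav].
  by exists (t - a v); rewrite linearB jav opprB addrC subrK.
Qed.

Lemma cores_le_sum n k M N :
  cores_le n k M -> cores_le n k N -> cores_le n k (M * N)%type.
Proof.
apply: (@cores_le_extension _ _ _ _ _ (pair_map idfun \0)
          (snd : {linear (M * N)%type -> N})); split.
- by move=> x y [].
- by move=> y; exists (0, y).
- by move=> [x y]; split=> /= [->|[z [_ <-]] //]; exists x.
Qed.

Lemma row_retract m : retract 'rV[R]_m.+1 (R^o * 'rV[R]_m)%type.
Proof.
have s_lin : linear (fun v : 'rV[R]_m.+1 =>
    (v 0 0 : R^o, \row_j v 0 (lift ord0 j)) : (R^o * 'rV[R]_m)%type).
  move=> a x y; congr pair; first by rewrite !mxE.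
  by apply/rowP => j; rewrite !mxE.
have p_lin : linear (fun v : (R^o * 'rV[R]_m)%type =>
    \row_j (if unlift ord0 j is Some l then v.2 0 l else v.1 : R) : 'rV[R]_m.+1).
  move=> a x y; apply/rowP => j; rewrite !mxE.
  by case: (unlift ord0 j) => [l|] //; rewrite !mxE.
exists (lin s_lin), (lin p_lin) => v; apply/rowP => j; rewrite !mxE /=.
by case: unliftP => [l|] ->; rewrite ?mxE.
Qed.

Lemma cores_le_row n k m : cores_le n k R^o -> cores_le n k 'rV[R]_m.
Proof.
move=> R_le; elim: m => [|m IHm].
  apply: cores_le_retract R_le; exists \0, \0 => x /=.
  by apply/rowP => -[].
by apply: cores_le_retract (@row_retract m) _; apply: cores_le_sum.
Qed.

(** The minimal resolution satisfies the bounds of any other one. *)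
Lemma fd_inj_leP n k M : fd_inj_le n k M <-> cores_le n k M.
Proof.
split=> [M_le|M_le I]; last exact: cores_le_min (retract_refl M) M_le.
by have [I] := min_injective_resolution_exists M; apply: min_cores_le (M_le I).
Qed.

End Envelopes.


(** * Finitely generated modules over noetherian rings *)

Section Span.
Variable R : pzRingType.
Implicit Types M N : lmodType R.

Fixpoint span M (gs : seq M) (x : M) : Prop :=
  if gs is g :: gs' then exists r y, x = r *: g + y /\ span gs' y else x = 0.

Lemma span_submodule M (gs : seq M) : submodule (span gs).
Proof.
elim: gs => [|g gs IHgs].
  by split=> // a x y /= -> ->; rewrite scaler0 addr0.
split=> [|a _ _ [r [x [-> Sx]]] [s [y [-> Sy]]]] /=.
  by exists 0, 0; rewrite scale0r addr0; split=> //; apply: submodule0.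
exists (a * r + s), (a *: x + y); split; last exact: IHgs.2.
by rewrite scalerDr scalerDl addrACA scalerA.
Qed.

Lemma span_cons M (g : M) gs x : span gs x -> span (g :: gs) x.
Proof. by move=> gs_x; exists 0, x; rewrite scale0r add0r. Qed.

Lemma span_head M (g : M) gs : span (g :: gs) g.
Proof.
by exists 1, 0; rewrite scale1r addr0; split=> //; apply: (submodule0 (span_submodule _)).
Qed.

Lemma span_sub M (S : M -> Prop) g gs : submodule S -> S g ->
  (forall x, span gs x -> S x) -> forall x, span (g :: gs) x -> S x.
Proof. by move=> S_sub Sg Sgs _ [r [y [-> /Sgs Sy]]]; apply: S_sub.2. Qed.

Lemma span_cat M (gs hs : seq M) x y :
  span gs x -> span hs y -> span (gs ++ hs) (x + y).
Proof.
elim: gs x => [|g gs IHgs] x /=; first by move=> ->; rewrite add0r.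
move=> [r [z [-> Sz]]] Sy; exists r, (z + y); rewrite addrA; split=> //.
exact: IHgs.
Qed.

Lemma span_cat_sub M (S : M -> Prop) gs hs : submodule S ->
  (forall x, span gs x -> S x) -> (forall x, span hs x -> S x) ->
  forall x, span (gs ++ hs) x -> S x.
Proof.
move=> S_sub; elim: gs => // g gs IHgs Sg Shs.
apply: span_sub => //; first by apply/Sg/span_head.
by apply: IHgs => // x /(span_cons g); apply: Sg.
Qed.

Lemma finitely_generatedP M :
  finitely_generated M <-> exists gs, forall x : M, span gs x.
Proof.
split=> [[m [g gP]]|[gs gsP]].
  exists (map g (index_enum 'I_m)) => x; have [c ->] := gP x.
  elim: index_enum => [|i s IHs] /=; first by rewrite big_nil.
  by rewrite big_cons; exists (c i), (\sum_(j <- s) c j *: g j).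
exists (size gs), (fun i => gs`_i) => x.
suff [c ->] : exists c : nat -> R, x = \sum_(i < size gs) c i *: gs`_i.
  by exists (fun i => c i).
elim: gs x {gsP} (gsP x) => [|g gs IHgs] x /=.
  by move=> ->; exists (fun=> 0); rewrite big_ord0.
move=> [r [y [-> /IHgs [c ->]]]]; exists (fun i => if i is j.+1 then c j else r).
by rewrite big_ord_recl.
Qed.

Lemma surjection_fg M N (q : {linear M -> N}) :
  surjective q -> finitely_generated M -> finitely_generated N.
Proof.
move=> q_surj [m [g gP]]; exists m, (q \o g) => y; have [x <-] := q_surj y.
have [c ->] := gP x; exists c; rewrite linear_sum.
by apply: eq_bigr => i _; rewrite linearZ.
Qed.

(** A submodule that is not finitely generated contains a strictly increasing
    sequence of finitely generated submodules. *)
Lemma noetherian_span M (S : M -> Prop) :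
  noetherian_module M -> submodule S -> exists gs, forall x, S x <-> span gs x.
Proof.
move=> M_noeth S_sub; apply: contrapT => not_fg.
have /choice [next nextP] gs : exists x,
    (forall y, span gs y -> S y) -> S x /\ ~ span gs x.
  have [gsS|] := EM (forall y, span gs y -> S y); last by exists 0.
  apply: contrapT => none; apply: not_fg; exists gs => x; split=> [Sx|/gsS//].
  by apply: contrapT => ngs; apply: none; exists x.
pose fix hs i := if i is j.+1 then next (hs j) :: hs j else [::].
have hsS i : forall y, span (hs i) y -> S y.
  elim: i => [y ->|i IHi]; first exact: submodule0.
  by apply: span_sub => //; case: (nextP _ IHi).
have [||m m_stable] := M_noeth (fun i => [pred x | `[< span (hs i) x >]]).
- move=> i; split=> [|a u v /asboolP Su /asboolP Sv]; apply/asboolP.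
    exact: (submodule0 (span_submodule _)).
  exact: (span_submodule _).2.
- by move=> i x /asboolP Sx; apply/asboolP/span_cons.
have [_] := nextP _ (hsS m); apply.
have /asboolP // : next (hs m) \in [pred x | `[< span (hs m) x >]].
rewrite -(m_stable m.+1 (leqnSn m) (next (hs m))).
exact/asboolP/span_head.
Qed.

(** The coefficients at the first generator of the elements of [S] form a left
    ideal; finitely many elements of [S] reduce [S] to the span of the other
    generators. *)
Lemma noetherian_sub_span M (gs : seq M) (S : M -> Prop) :
  noetherian_module R^o -> submodule S -> (forall x, S x -> span gs x) ->
  exists hs, forall x, S x <-> span hs x.
Proof.
move=> R_noeth; elim: gs S => [|g gs IHgs] S S_sub Sgs.
  by exists [::] => x; split=> [/Sgs//|/= ->]; apply: submodule0.
have gs_sub := span_submodule gs.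
pose J : R^o -> Prop := fun r : R => exists y, span gs y /\ S (r *: g + y).
have J_sub : submodule J.
  split=> [|a r s [x [Sx Srx]] [y [Sy Ssy]]].
    by exists 0; rewrite scale0r addr0; split; apply: submodule0.
  exists (a *: x + y); split; first exact: gs_sub.2.
  have := S_sub.2 a _ _ Srx Ssy; rewrite scalerDr addrACA scalerA.
  by rewrite -scalerDl.
have [rs rsP] := noetherian_span R_noeth J_sub.
have [hs [hsS hsP]] : exists hs, (forall x, span hs x -> S x) /\
    forall r : R, span rs (r : R^o) -> exists x, span hs x /\ span gs (x - r *: g).
  have : forall r, span rs r -> J r by move=> r /rsP.
  elim: rs {rsP} => [|r rs IHrs] rsJ.
    exists [::]; split=> [x ->|s ->]; first exact: submodule0.
    by exists 0; rewrite scale0r subr0; split=> //; apply: submodule0.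
  have [s /(span_cons r)/rsJ//|hs [hsS hsP]] := IHrs.
  have [y [Sy Sry]] := rsJ r (span_head _ _).
  exists ((r : R) *: g + y :: hs); split; first exact: span_sub.
  move=> _ [a [s [-> /hsP [x [hs_x gs_x]]]]].
  exists (a *: ((r : R) *: g + y) + x); split; first by exists a, x.
  have -> : a *: ((r : R) *: g + y) + x - (a * r + s : R) *: g =
      a *: y + (x - (s : R) *: g).
    rewrite scalerDr scalerDl scalerA opprD.
    by rewrite -[_ + x]addrA addrACA subrr add0r addrA.
  exact: gs_sub.2.
have [|x [_]//|ks ksP] := IHgs (fun x => S x /\ span gs x).
  split=> [|a x y [Sx gx] [Sy gy]]; first by split; apply: submodule0.
  by split; [apply: S_sub.2 | apply: gs_sub.2].
exists (hs ++ ks) => x; split=> [Sx|]; last first.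
  by apply: span_cat_sub => // y /ksP [].
have [r [y [xE gy]]] := Sgs x Sx.
have [|z [hs_z gs_z]] := hsP r; first by apply/rsP; exists y; rewrite -xE.
rewrite -(subrK z x) addrC; apply: span_cat => //; apply/ksP; split.
  by apply: submoduleB => //; apply: hsS.
rewrite xE; have := submoduleB gs_sub gy gs_z.
by rewrite opprB addrA [y + _]addrC.
Qed.

Lemma submodule_fg (M K : lmodType R) (i : {linear K -> M}) :
  noetherian_module R^o -> finitely_generated M -> injective i ->
  finitely_generated K.
Proof.
move=> R_noeth /finitely_generatedP [gs gsP] i_inj; apply/finitely_generatedP.
have [//|hs hsP] := noetherian_sub_span (gs := gs) R_noeth (image_submodule i).
have [ks ksP] : exists ks, map i ks = hs.
  have {hsP} : forall x, span hs x -> exists k, i k = x by move=> x /hsP.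
  elim: hs => [|h hs IHhs] hsP; first by exists [::].
  have [x /(span_cons h)/hsP//|ks <-] := IHhs.
  by have [k <-] := hsP h (span_head _ _); exists (k :: ks).
exists ks => k.
have : span (map i ks) (i k) by rewrite ksP; apply/hsP; exists k.
elim: ks {hs hsP ksP} k => [|g ks IHks] k /=; first exact: injective_kernel.
move=> [r [y [ikE sy]]]; exists r, (k - r *: g); split.
  by rewrite addrC subrK.
by apply: IHks; rewrite linearB linearZ ikE addrC addKr.
Qed.

(** * Finitely generated projective modules *)

Definition dual_basis (P : lmodType R) : Prop :=
  exists (m : nat) (x : 'I_m -> P) (f : 'I_m -> {linear P -> R^o}),
    forall p, p = \sum_i (f i p : R) *: x i.

Definition row_comb M m (g : 'I_m -> M) (v : 'rV[R]_m) : M := \sum_i v 0 i *: g i.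

Lemma row_comb_linear M m (g : 'I_m -> M) : linear (row_comb g).
Proof.
move=> a u v; rewrite /row_comb scaler_sumr -big_split.
by apply: eq_bigr => i _; rewrite /= !mxE scalerDl scalerA.
Qed.

Lemma entry_linear m (i : 'I_m) : linear (fun v : 'rV[R]_m => v 0 i : R^o).
Proof. by move=> a u v; rewrite !mxE. Qed.

Lemma row_dual_basis m : dual_basis 'rV[R]_m.
Proof.
exists m, (fun i => delta_mx 0 i), (fun i => lin (entry_linear i)) => v.
exact: row_sum_delta.
Qed.

Lemma fg_row M : finitely_generated M ->
  exists (m : nat) (p : {linear 'rV[R]_m -> M}), surjective p.
Proof.
move=> [m [g gP]]; exists m, (lin (row_comb_linear g)) => x.
have [c ->] := gP x; exists (\row_i c i); apply: eq_bigr => i _.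
by rewrite mxE.
Qed.

Lemma fg_projective_row P : fg_projective P -> exists m, retract P 'rV[R]_m.
Proof.
move=> [/fg_row [m [p p_surj]] P_proj].
by have [s sP] := P_proj _ _ p idfun p_surj; exists m, s, p.
Qed.

Lemma fg_projectiveP P : fg_projective P <-> dual_basis P.
Proof.
split=> [/fg_projective_row [m [s [p ps]]]|[m [x [f xf]]]].
  have [k [x [f xf]]] := row_dual_basis m.
  exists k, (p \o x), (fun i => f i \o s : {linear _ -> _}) => y.
  rewrite -[LHS]ps [s y]xf linear_sum; apply: eq_bigr => i _.
  by rewrite linearZ.
split; first by exists m, x => p; exists (fun i => f i p).
move=> A B g h g_surj; have [s gs] := choice g_surj.
have k_lin : linear (fun p => \sum_i (f i p : R) *: s (h (x i))).
  move=> a u v; rewrite scaler_sumr -big_split; apply: eq_bigr => i _ /=.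
  by rewrite linearP scalerDl scalerA.
exists (lin k_lin) => p; rewrite /= linear_sum [in RHS](xf p) linear_sum.
by apply: eq_bigr => i _; rewrite !linearZ gs.
Qed.

Lemma ring_fg_projective : fg_projective R^o.
Proof.
apply/fg_projectiveP; exists 1%N, (fun=> 1), (fun=> idfun) => r.
by rewrite big_ord1; apply/esym/mulr1.
Qed.

Lemma row_fg_projective m : fg_projective 'rV[R]_m.
Proof. exact/fg_projectiveP/row_dual_basis. Qed.

Lemma fg_presentation M : noetherian_module R^o -> finitely_generated M ->
  exists (m : nat) (K : lmodType R) (i : {linear K -> 'rV[R]_m})
    (p : {linear 'rV[R]_m -> M}), short_exact i p /\ finitely_generated K.
Proof.
move=> R_noeth /fg_row [m [p p_surj]]; have [K [i [i_inj ip]]] := kernel p.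
exists m, K, i, p; split=> //.
by apply: submodule_fg i_inj => //; case: (row_fg_projective m).
Qed.

Record fg_cover M := FgCover {
  cover : lmodType R;
  cover_syzygy : lmodType R;
  syzygy_map : {linear cover_syzygy -> cover};
  cover_map : {linear cover -> M};
  cover_exact : short_exact syzygy_map cover_map;
  cover_projective : fg_projective cover;
  cover_syzygy_fg : finitely_generated cover_syzygy
}.

Lemma fg_resolution M : noetherian_module R^o -> finitely_generated M ->
  exists X : left_resolution M, forall i, fg_projective (X i).
Proof.
move=> R_noeth M_fg.
have [step] : inhabited (forall N, finitely_generated N -> fg_cover N).
  split=> N N_fg; apply: inhabited_witness.
  have [m [K [i [p [ip K_fg]]]]] := fg_presentation R_noeth N_fg.
  by split; apply: FgCover ip (row_fg_projective m) K_fg.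
pose Z := fix Z i : {N : lmodType R | finitely_generated N} :=
  if i is j.+1
  then exist _ (cover_syzygy (step _ (svalP (Z j))))
               (cover_syzygy_fg (step _ (svalP (Z j))))
  else exist _ M M_fg.
pose c i := step _ (svalP (Z i)).
pose d i : {linear cover (c i.+1) -> cover (c i)} :=
  syzygy_map (c i) \o cover_map (c i.+1).
have ker_d i x : d i x = 0 <-> cover_map (c i.+1) x = 0.
  have [s_inj _ _] := cover_exact (c i).
  by split=> [/(injective_kernel s_inj)|/= ->] //; rewrite linear0.
have im_d i y : (exists x, d i x = y) <-> cover_map (c i) y = 0.
  have [_ _ ->] := cover_exact (c i).
  have [_ c_surj _] := cover_exact (c i.+1).
  split=> [[x <-]|[z <-]]; first by eexists.
  by have [x <-] := c_surj z; exists x.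
unshelve eexists.
- apply: (@LeftResolution R M (fun i => cover (c i)) d (cover_map (c 0%N))).
  + by case: (cover_exact (c 0%N)).
  + by move=> y; rewrite im_d.
  + by move=> i y; rewrite im_d ker_d.
- by move=> i; apply: cover_projective.
Qed.

End Span.

(** * Duality for finitely generated projective modules *)

Section DualProjective.
Variable R : pzRingType.
Implicit Types M P : lmodType R.

Definition dual_fun M (g : dual M) : {linear M -> R^o} := g.

Definition evaluation M (p : M) (g : dual M) : R^c^o := dual_fun g p.

Lemma evaluation_linear M (p : M) : linear (evaluation p).
Proof. by []. Qed.

HB.instance Definition _ M (p : M) :=
  GRing.isLinear.Build R^c (dual M) R^c^o *:%R (evaluation p)
    (evaluation_linear p).

Lemma dual_fg_projective P : fg_projective P -> fg_projective (dual P).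
Proof.
move=> /fg_projectiveP [m [x [f xf]]]; apply/fg_projectiveP.
exists m, f, (fun i => evaluation (x i) : {linear _ -> _}) => g.
apply: dual_ext => p; rewrite -[RHS]/(evaluation p _) linear_sum.
rewrite [in LHS](xf p) linear_sum; apply: eq_bigr => i _.
by rewrite linearZ /= linearZ.
Qed.

Lemma projective_reflexive P (phi : {linear dual P -> R^c^o}) :
  fg_projective P -> exists p, forall g, phi g = dual_fun g p.
Proof.
move=> /fg_projectiveP [m [x [f xf]]].
exists (\sum_i (phi (f i) : R) *: x i) => g.
have gE : g = \sum_i (dual_fun g (x i) : R^c) *: (f i : dual P).
  apply: dual_ext => p; rewrite -[RHS]/(evaluation p _) linear_sum.
  rewrite [in LHS](xf p) linear_sum; apply: eq_bigr => i _.
  by rewrite linearZ /= linearZ.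
rewrite [in LHS]gE !linear_sum; apply: eq_bigr => i _.
by rewrite linearZ /= linearZ.
Qed.

Lemma projective_torsionless P (p p' : P) :
  fg_projective P -> (forall g : dual P, dual_fun g p = dual_fun g p') -> p = p'.
Proof.
move=> /fg_projectiveP [m [x [f xf]]] pp'; rewrite (xf p) (xf p').
by apply: eq_bigr => i _; congr (_ *: _); apply: (pp' (f i)).
Qed.

End DualProjective.

(** The dual of a right module is a module over the converse of the converse of
    [R], which is to be read as a left [R]-module. *)
Definition unconverse (R : pzRingType) (N : lmodType R^c^c) : Type := N.

Section Unconverse.
Variables (R : pzRingType) (N : lmodType R^c^c).

HB.instance Definition _ := GRing.Zmodule.on (unconverse N).

Definition unconverse_scale (r : R) (x : unconverse N) : unconverse N :=
  (r : R^c^c) *: (x : N).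

Lemma unconverse_scaleA a b x :
  unconverse_scale a (unconverse_scale b x) = unconverse_scale (a * b) x.
Proof. exact: scalerA. Qed.
Lemma unconverse_scale1 : left_id 1 unconverse_scale.
Proof. exact: scale1r. Qed.
Lemma unconverse_scaleDr : right_distributive unconverse_scale +%R.
Proof. by move=> r x y; exact: (@scalerDr _ N). Qed.
Lemma unconverse_scaleDl x : {morph unconverse_scale^~ x : a b / a + b}.
Proof. by move=> a b; exact: (@scalerDl _ N). Qed.

HB.instance Definition _ := GRing.Zmodule_isLmodule.Build R (unconverse N)
  unconverse_scaleA unconverse_scale1 unconverse_scaleDr unconverse_scaleDl.

Lemma unconverse_fg_projective : fg_projective N -> fg_projective (unconverse N).
Proof.
move=> /fg_projectiveP [m [x [f xf]]]; apply/fg_projectiveP.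
have f_lin i : linear (fun y : unconverse N => f i y : R^o).
  by move=> a y z; apply: (linearP (f i)).
by exists m, x, (fun i => lin (f_lin i)) => p; apply: xf.
Qed.

End Unconverse.

Lemma unconverse_linear (R : pzRingType) (M N : lmodType R^c^c)
    (f : {linear M -> N}) : linear (f : unconverse M -> unconverse N).
Proof. by move=> a x y; apply: (linearP f). Qed.

(** * Syzygies and modules of Gorenstein dimension zero *)

Section Syzygies.
Variable R : pzRingType.
Implicit Types M P : lmodType R.

Lemma cores_le_leq n n' k M : (n <= n')%N -> cores_le n' k M -> cores_le n k M.
Proof.
elim: n n' k M => // n IHn [|n'] // k M nn' [E [C [i [q [iq E_inj E_le C_le]]]]].
by exists E, C, i, q; split=> //; apply: IHn C_le.
Qed.

Lemma cores_le_projective n k P :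
  cores_le n k R^o -> fg_projective P -> cores_le n k P.
Proof.
move=> R_le /fg_projective_row [m P_row].
exact: cores_le_retract P_row (cores_le_row m R_le).
Qed.

(** By [cores_le_syzygy] the condition gains one step with each syzygy. *)
Lemma cores_le_resolution k n j (A : lmodType R) (X : left_resolution A) :
  cores_le (j + n) k R^o -> cores_le j k A ->
  (forall i, (i < n)%N -> fg_projective (X i)) ->
  (forall i, (n < i)%N -> zero_module (X i)) -> cores_le (j + n) k (X n).
Proof.
elim: n j A X => [|n IHn] j A X R_le A_le X_proj X0.
  rewrite addn0; apply: cores_le_retract A_le.
  have aug_inj : injective (lres_aug X).
    apply: kernel_injective => x /lres_exact0 [y <-].
    by rewrite (X0 1%N isT y) linear0.
  have [|h hP] := @factor_through_surjection _ _ _ _ (lres_aug X) idfun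
    (@lres_aug_surj _ _ X); first by move=> x; apply: injective_kernel.
  by exists (lres_aug X), h.
have [K [r [i [r_surj i_inj ir]]]] := image_factorization (lres_d X 0).
have K_le : cores_le j.+1 k K.
  apply: cores_le_syzygy (tail_short_exact r_surj i_inj ir) _ A_le.
  apply: cores_le_projective (X_proj 0%N isT).
  by apply: cores_le_leq R_le; rewrite addnS ltnS leq_addr.
rewrite addnS -addSn in R_le *.
by apply: (IHn j.+1 K (tail_resolution r_surj i_inj ir)) => // l ln;
   [apply: X_proj | apply: X0].
Qed.

Lemma cores_le_syzygy_module n k (A : lmodType R) :
  cores_le n k R^o -> syzygy_module n A -> cores_le n k A.
Proof.
move=> R_le [_ [B [X [_ X_proj /isomorphic_retract A_X X0]]]].
by apply: cores_le_retract A_X _; apply: (cores_le_resolution (j := 0)).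
Qed.

(** The cosyzygy in [K n] has the resolution [M -> K 0 -> ... -> K (n - 1)], which
    is prolonged by one term when passing to the next cosyzygy. *)
Lemma coresolution_syzygy_module M (K : nat -> lmodType R)
    (d : forall j, {linear K j -> K j.+1}) (e : {linear M -> K 0%N}) n :
  finitely_generated M -> (forall j, fg_projective (K j)) ->
  injective e -> exact e (d 0%N) -> (forall j, exact (d j) (d j.+1)) ->
  syzygy_module n M.
Proof.
move=> M_fg K_proj e_inj ed dd; split=> //.
suff [C [e' [X [_ _ C_fg MX]]]] : exists (C : lmodType R) (e' : {linear C -> K n})
    (X : left_resolution C), [/\ injective e', exact e' (d n), finitely_generated C
    & [/\ forall i, (i < n)%N -> fg_projective (X i), isomorphic M (X n)
        & forall i, (n < i)%N -> zero_module (X i)]].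
  by case: MX => MX1 MX2 MX3; exists C, X.
elim: n => [|n [C [e' [X [e'_inj e'd C_fg [X_proj MX X0]]]]]].
  exists M, e, (resolution_in_degree_zero M); split=> //; split=> //.
    by exists idfun; exists id.
  by case=> // i _; apply: null_moduleP.
have [D [q [i [q_surj i_inj iq]]]] := image_factorization (d n).
have e'q : short_exact e' q.
  split=> // y; rewrite -e'd -iq; split=> [->|]; first exact: linear0.
  exact: injective_kernel.
exists D, i, (cons_resolution e'q X); split=> //.
- move=> y; rewrite (dd n y); split=> [[x <-]|[z <-]]; first by exists (q x).
  by have [x <-] := q_surj z; exists x.
- by apply: surjection_fg q_surj _; case: (K_proj n).
- by split=> // -[|l] //= ln; [apply: X_proj | apply: X0].
Qed.

(** [R] has the coresolution [0 -> R -1-> R -0-> R -1-> R -0-> ...]. *)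
Lemma ring_syzygy_module n : syzygy_module n R^o.
Proof.
have R_proj := ring_fg_projective R.
pose d j : {linear R^o -> R^o} :=
    if odd j then (idfun : {linear R^o -> R^o}) else (\0 : {linear R^o -> R^o}).
apply: (@coresolution_syzygy_module _ (fun=> R^o) d idfun) => //.
- by case: R_proj.
- by move=> y; split=> // _; exists y.
- move=> j y; rewrite /d /=; case: (odd j) => /=.
    by split=> // _; exists y.
  by split=> [->|[x <-]] //; exists 0.
Qed.

End Syzygies.

Section ExtProjective.
Variable R : pzRingType.
Implicit Types M N P : lmodType R.

(** The first syzygy of a projective module is a direct factor of [P 0]: cocycles
    on it extend to [P 0], and it is projective in turn. *)
Lemma Ext_projective i M N : projective M -> (0 < i)%N -> Ext_zero i M N.
Proof.
case: i => // i M_proj _; elim: i M M_proj => [|i IHi] M M_proj P P_proj f f_cocycle.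
all: have [K [r [j [r_surj j_inj jr]]]] := image_factorization (lres_d P 0).
all: have [_ aug_surj jaug] := tail_short_exact r_surj j_inj jr.
all: have [s sP] := M_proj _ _ (lres_aug P) idfun aug_surj.
all: have [|u uP] := @factor_through_injection _ _ _ _ j
       (idfun \- (s \o lres_aug P) : {linear P 0%N -> P 0%N}) j_inj;
     first by move=> x; apply/jaug; rewrite /= linearB sP subrr.
all: have uj y : u (j y) = y by
       apply: j_inj; rewrite uP /=; have /jaug -> : exists z, j z = j y;
       [exists y | rewrite linear0 subr0].
- have [|h hr] := @factor_through_surjection _ _ _ _ r f r_surj.
    move=> x; move/(congr1 j); rewrite jr linear0 => /lres_exact [y <-].
    exact: f_cocycle.
  by exists (h \o u : {linear _ -> _}) => x /=; rewrite -jr uj hr.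
- have K_proj : projective K.
    move=> A B g h g_surj.
    have [k kP] := P_proj 0%N _ _ g (h \o u : {linear _ -> _}) g_surj.
    by exists (k \o j : {linear _ -> _}) => x /=; rewrite kP /= uj.
  have := IHi K K_proj (tail_resolution r_surj j_inj jr) (fun l => P_proj l.+1) f.
  exact.
Qed.

Lemma projective_retract M N : retract M N -> projective N -> projective M.
Proof.
move=> [s [p ps]] N_proj A B g f g_surj.
have [h hP] := N_proj _ _ g (f \o p : {linear _ -> _}) g_surj.
by exists (h \o s : {linear _ -> _}) => x /=; rewrite hP /= ps.
Qed.

End ExtProjective.

Section Gorenstein.
Variable R : pzRingType.
Implicit Types M N P : lmodType R.

(** A presentation [f] of a projective module has a quasi-inverse [s], that is
    [f s f = f]; hence [f^*] has one too, and its cokernel is a direct factor. *)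
Lemma transpose_projective M T :
  projective M -> is_transpose M T -> projective T.
Proof.
move=> M_proj [P1 [P0 [f [p [q [[P1_fgp P0_fgp] p_surj fp q_surj fq]]]]]].
have [I [r [i [r_surj i_inj ir]]]] := image_factorization f.
have [sg sgP] := M_proj _ _ p idfun p_surj.
have [|u uP] := @factor_through_injection _ _ _ _ i
    (idfun \- (sg \o p) : {linear P0 -> P0}) i_inj.
  move=> x; have /fp [y yx] : p (x - sg (p x)) = 0 by rewrite linearB sgP subrr.
  by exists (r y); rewrite ir.
have [s sP] := P0_fgp.2 _ _ r u r_surj.
have fsf x : f (s (f x)) = f x.
  rewrite -ir sP uP /=; have /fp -> : exists y, f y = f x by exists x.
  by rewrite linear0 subr0.
have [|tau tauP] := @factor_through_surjection _ _ _ _ q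
    (idfun \- (dual_map f \o dual_map s) : {linear dual P1 -> dual P1}) q_surj.
  move=> y /fq [x <-] /=; apply/eqP; rewrite subr_eq0; apply/eqP/dual_ext => z.
  by rewrite -[RHS]/(dual_fun x (f (s (f z)))) fsf.
apply: (@projective_retract _ T (dual P1)); last by case: (dual_fg_projective P1_fgp).
exists tau, q => y; have [x <-] := q_surj y; rewrite tauP /= linearB.
have /fq -> : exists z, dual_map f z = dual_map f (dual_map s x) by eexists.
exact: subr0.
Qed.

Lemma ring_Gorenstein_dim_zero : Gorenstein_dim_zero R^o.
Proof.
have [R_fg R_proj] := ring_fg_projective R.
split=> // [i|T T_tr i]; apply: Ext_projective => //.
exact: transpose_projective T_tr.
Qed.

End Gorenstein.


(** Dualizing a projective resolution [... -> Y 0 -> P0^* -> P1^*] of the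
    transpose of [G] gives a coresolution [G -> (Y 0)^* -> (Y 1)^* -> ...]: its
    exactness is the vanishing of [Ext^i(Tr G, R)], read through the
    reflexivity of [P1] and [P0] in the first two degrees. *)
Theorem Gorenstein_syzygy_module (R : pzRingType) (G : lmodType R) n :
  left_noetherian R -> right_noetherian R -> Gorenstein_dim_zero G ->
  syzygy_module n G.
Proof.
move=> Rl Rr [G_fg _ G_Ext].
have [m0 [K0 [i0 [p [[i0_inj p_surj i0p] K0_fg]]]]] := fg_presentation Rl G_fg.
have [m1 [p1 p1_surj]] := fg_row K0_fg.
pose P0 : lmodType R := 'rV[R]_m0; pose P1 : lmodType R := 'rV[R]_m1.
have P0_proj : fg_projective P0 := row_fg_projective R m0.
have P1_proj : fg_projective P1 := row_fg_projective R m1.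
pose f : {linear P1 -> P0} := i0 \o p1.
have fp : exact f p.
  move=> y; rewrite i0p; split=> [[k <-]|[x <-]]; last by exists (p1 x).
  by have [x <-] := p1_surj k; exists x.
have [T [q [q_surj fq]]] := cokernel (dual_map f : {linear dual P0 -> dual P1}).
have T_Ext i : (0 < i)%N -> Ext_zero i T R^c^o.
  by apply: G_Ext; exists P1, P0, f, p, q; split.
have [I [r [i [r_surj i_inj ir]]]] :=
  image_factorization (dual_map f : {linear dual P0 -> dual P1}).
have iq : short_exact i q.
  split=> // y; rewrite fq; split=> [[g <-]|[z <-]]; first by exists (r g).
  by have [g <-] := r_surj z; exists g.
have [K2 [k [k_inj kr]]] := kernel r.
have kr_ex : short_exact k r by [].
have [P0d_fg P0d_proj] := dual_fg_projective P0_proj.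
have [Y Y_proj] := fg_resolution Rr (submodule_fg Rr P0d_fg k_inj).
pose X := cons_resolution iq (cons_resolution kr_ex Y).
have X_proj j : projective (X j).
  case: j => [|[|j]] //=; last by case: (Y_proj j).
  by case: (dual_fg_projective P1_proj).
have X_Ext i' := T_Ext i'.+1 isT X X_proj.
pose d1 : {linear Y 0%N -> dual P0} := lres_d X 1.
have fd1 y : dual_map f (d1 y) = 0.
  by rewrite -ir; apply: (@lres_exact _ _ X 0 (d1 y)).2; exists y.
pose K j : lmodType R := unconverse (dual (Y j)).
pose d j : {linear K j -> K j.+1} :=
  lin (unconverse_linear (dual_map (lres_d Y j))).
pose e_fun (x : P0) : {linear Y 0%N -> R^c^o} := evaluation x \o d1.
have e_lin : linear (e_fun : P0 -> K 0%N).
  by move=> a x y; apply: dual_ext => z; rewrite -[LHS]/(dual_fun (d1 z) _) linearP.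
have ker_e x : p x = 0 <-> lin e_lin x = 0.
  split=> [/fp [z <-]|ex0].
    apply: dual_ext => y; rewrite -[LHS]/(dual_fun (dual_map f (d1 y)) z).
    by rewrite fd1.
  have [|phi phiP] := X_Ext 0%N (evaluation x : {linear dual P0 -> R^c^o}).
    by move=> y; apply: (congr1 (fun g : dual (Y 0%N) => dual_fun g y) ex0).
  have [z zP] := projective_reflexive phi P1_proj.
  apply/fp; exists z; apply: projective_torsionless P0_proj _ => g.
  rewrite -[RHS]/(evaluation x g) phiP zP.
  by rewrite -[in RHS]/(lres_d X 0 g) /= ir.
have [|e eP] := @factor_through_surjection _ _ _ _ p (lin e_lin) p_surj.
  by move=> x /ker_e.
apply: (@coresolution_syzygy_module R G K d e) => //.
- move=> j; apply: unconverse_fg_projective.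
  exact: dual_fg_projective.
- by apply: kernel_injective => y; have [x <-] := p_surj y; rewrite eP => /ker_e.
- move=> psi; split=> [psi0|[y <-]].
    have [|phi phiP] := X_Ext 1%N (psi : {linear Y 0%N -> R^c^o}).
      by move=> y; apply: (congr1 (fun g : dual (Y 1%N) => dual_fun g y) psi0).
    have [x xP] := projective_reflexive phi P0_proj.
    exists (p x); rewrite eP; apply: dual_ext => y.
    exact: (etrans (esym (xP (d1 y))) (esym (phiP y))).
  have [x <-] := p_surj y; rewrite eP; apply: dual_ext => z.
  rewrite -[LHS]/(dual_fun (d1 (lres_d Y 0 z)) x).
  have -> : d1 (lres_d Y 0 z) = 0.
    by apply: (@lres_exact _ _ X 1 _).2; exists z.
  by [].
- move=> j psi; split=> [psi0|[phi <-]].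
    have [|phi phiP] := X_Ext j.+2 (psi : {linear Y j.+1 -> R^c^o}).
      by move=> y; apply: (congr1 (fun g : dual (Y j.+2) => dual_fun g y) psi0).
    by exists phi; apply: dual_ext => y; apply: (esym (phiP y)).
  apply: dual_ext => y.
  rewrite -[LHS]/(dual_fun phi (lres_d Y j (lres_d Y j.+1 y))).
  have -> : lres_d Y j (lres_d Y j.+1 y) = 0.
    by apply: (@lres_exact _ _ Y j _).2; exists y.
  exact: linear0.
Qed.

Theorem corollary2p3 (R : pzRingType) (n k : nat) :
  left_noetherian R -> right_noetherian R -> (1 <= n)%N ->
  (G_op R n k <->
     (forall A : lmodType R, syzygy_module n A -> fd_inj_le n k A)) /\
  (G_op R n k <->
     (forall G : lmodType R, Gorenstein_dim_zero G -> fd_inj_le n k G)).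
Proof.
move=> Rl Rr _.
have R_syzygy : G_op R n k ->
    forall A : lmodType R, syzygy_module n A -> fd_inj_le n k A.
  by move=> /fd_inj_leP R_le A A_syz; apply/fd_inj_leP/cores_le_syzygy_module.
split; split=> //.
- by move=> syz_le; apply/syz_le/ring_syzygy_module.
- move=> R_le G G_dim0.
  exact/(R_syzygy R_le)/Gorenstein_syzygy_module.
- by move=> G_le; apply/G_le/ring_Gorenstein_dim_zero.
Qed.
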